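(* Let $k$ be $\mathbb{R}$ or $\mathbb{C}$, let $(\mathcal{L},\mathcal{B},(\cdot,\cdot))$ be a Maurer–Cartan–Poisson (MCP) structure over $k$, let $\mathcal{O}\subseteq\mathrm{MC}(\mathcal{L})$ be a set of gauge orbits, and let $[f]\in\mathcal{R}_{\mathcal{O}}$ be represented by the function $f$. Let $X\in\mathcal{O}$ be a Maurer–Cartan element. Then the hamiltonian flow of the MCP structure due to $[f]$ is given by $$\frac{dX}{dt}=\nu_XDf=d_X\rho_X\delta_XDf=d\,\rho_X\delta_XDf+[X,\rho_X\delta_XDf],$$ where $\nu_X=d_X\rho_X\delta_X:B^2\to L^1$ and $d$ is the differential of the base dgla $\mathcal{L}$.
   Context: For a differential graded Lie algebra (dgla) $\mathcal{L}=(L,d,[\cdot,\cdot])$, $\mathrm{MC}(\mathcal{L})=\{X\in L^1: dX+\frac12[X,X]=0\}$, and $d_X=d+[X,\cdot]$. The Lie algebra $L^0$ acts on $L^1$ by the vector fields $X\mapsto d\lambda+[X,\lambda]$; their flows preserve $\mathrm{MC}(\mathcal{L})$ and decompose it into gauge orbits. A BV algebra $(B,\delta,\wedge)$ is a graded vector space with an associative graded commutative product $\wedge:B^i\times B^j\to B^{i+j}$ and a differential $\delta:B^i\to B^{i-1}$, $\delta^2=0$, such that $[a,b]_{\mathcal{B}}=(-1)^{|a|}(\delta(a\wedge b)-\delta a\wedge b-(-1)^{|a|}a\wedge\delta b)$ is a graded Lie bracket (with degrees shifted by one), and $\delta$ is of order two: $\delta(a\wedge b\wedge c)-\delta(a\wedge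 b)\wedge c+\delta a\wedge b\wedge c-(-1)^{|a|}a\wedge\delta(b\wedge c)-(-1)^{(|a|+1)|b|}b\wedge\delta(a\wedge c)+(-1)^{|a|}a\wedge\delta b\wedge c+(-1)^{|a|+|b|}a\wedge b\wedge\delta c=0.$ An MCP structure with base dgla $\mathcal{L}$ is a triple $(\mathcal{L},\mathcal{B},(\cdot,\cdot))$ of a dgla $\mathcal{L}$, a graded commutative algebra $\mathcal{B}=(B,\wedge)$ and non-degenerate bilinear pairings $(\cdot,\cdot):L^i\times B^{i+1}\to k$ such that for each $X\in\mathrm{MC}(\mathcal{L})$: (1) $d_XX=0$; (2) the map $\delta_X:B^i\to B^{i-1}$ defined by $(d_X\,\cdot,\cdot)=(\cdot,\delta_X\,\cdot)$ makes $\mathcal{B}_X=(B,\delta_X,\wedge)$ a BV algebra; (3) there is $k_X\in k$ such that the linear map $\rho_X:B^1\to L^0$ defined by $(X,a\wedge b)=(\rho_Xa,b)$ satisfies $[\rho_Xa,\rho_Xb]=k_X\rho_X[a,b]_{\mathcal{B}_X}$ for all $a,b\in B^1$. The ring $\mathcal{R}_{\mathcal{O}}$ is defined in two settings. (a) If $L$ is finite-dimensional, $\mathcal{R}_{\mathcal{O}}=C^\infty(L^1)/\mathcal{I}$, where $\mathcal{I}$ is the ideal of smooth functions vanishing on $\mathcal{O}$. (b) In the vector bundle setting, each $L^i=\Gamma(E^i)$ is the space of sections of a smooth vector bundle over a smooth manifold $M$ with a fixed volume form $\mu$, $B^{i+1}=\Gamma((E^i)^* )$, the pairing is (up to a sign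 depending only on $i$) the integral over $M$ against $\mu$ of the fiberwise pairing, $\wedge$ and $\rho_X$ act fiberwise, $d_X$ and $\delta_X$ are differential operators, and for every $\lambda\in L^0$ the gauge transformation by $\epsilon\lambda$ is assumed to exist for some $\epsilon\neq0$; then $\mathcal{R}_{\mathcal{O}}=\mathcal{C}/\mathcal{I}$, where $\mathcal{C}$ is the space of local functionals $X\mapsto\int_M F(j_rX)\mu$ ($F$ a smooth function on a finite-order jet bundle of $E^1$), and $\mathcal{I}$ consists of those vanishing on $\mathcal{O}$. In both settings $Df$ is the derivative of $f$, viewed at each $X\in L^1$ as an element of $B^2$ by $\frac{d}{dt}f(X(t))=(\dot X,Df)$. The Poisson bracket on $\mathcal{R}_{\mathcal{O}}$ is $\{[f],[g]\}=(X,\delta_XDf\wedge\delta_XDg)$, and the hamiltonian flow of $[f]$ is the flow along which every $[g]$ evolves by $\frac{d}{dt}[g]=\{[f],[g]\}$. *)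

(* Defs.v *)
From HB Require Import structures.
From mathcomp Require Import all_boot all_order all_algebra.
From mathcomp Require Import all_classical all_reals all_analysis.
From mathcomp Require Import complex.
From Stdlib Require Import Relation_Operators.
Set Implicit Arguments.
Unset Strict Implicit.
Unset Printing Implicit Defensive.
Import Order.TTheory GRing.Theory Num.Theory.
Import numFieldNormedType.Exports.
Local Open Scope classical_set_scope.
Local Open Scope ring_scope.

Inductive scalars := RealScalars | ComplexScalars.

Definition field_of (R : realType) (s : scalars) : numFieldType :=
  match s with
  | RealScalars => (R : numFieldType)
  | ComplexScalars => (R[i] : numFieldType)
  end.

Section Scalars.
Variables (R : realType) (s : scalars).
Local Notation k := (field_of R s).

Definition kre : k -> R :=
  match s return field_of R s -> R with
  | RealScalars => fun x => x
  | ComplexScalars => fun x => complex.Re x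
  end.

Definition kim : k -> R :=
  match s return field_of R s -> R with
  | RealScalars => fun=> 0
  | ComplexScalars => fun x => complex.Im x
  end.

(* a + i b; the imaginary part is dropped when k = R. *)
Definition kmk : R -> R -> k :=
  match s return R -> R -> field_of R s with
  | RealScalars => fun a _ => a
  | ComplexScalars => fun a b => Complex a b
  end.

Definition kreal (a : R) : k := kmk a 0.

Definition has_deriv (u : R -> k) (t : R) (v : k) : Prop :=
  is_derive t (1 : R) (kre \o u) (kre v) /\
  is_derive t (1 : R) (kim \o u) (kim v).

End Scalars.

(* A graded space is a family indexed by int.  Operations carry a proof of the
   degree identity that they satisfy, so that no transport between degrees is
   needed in the axioms. *)

Record dgla (k : fieldType) := Dgla {
  lie_car :> int -> lmodType k;
  lie_d : forall i j : int, i + 1 = j -> {linear lie_car i -> lie_car j};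
  lie_br : forall i j m : int, i + j = m ->
    lie_car i -> lie_car j -> lie_car m;
  lie_br_linl : forall (i j m : int) (e : i + j = m) y,
    linear (fun x => lie_br e x y);
  lie_br_linr : forall (i j m : int) (e : i + j = m) x,
    linear (lie_br e x);
  lie_antisym : forall (i j m : int) (e : i + j = m) (e' : j + i = m) x y,
    lie_br e x y = - ((-1) ^ (i * j) *: lie_br e' y x);
  lie_jacobi : forall (i j l ij jl il m : int)
    (ejl : j + l = jl) (e1 : i + jl = m) (eij : i + j = ij) (e2 : ij + l = m)
    (eil : i + l = il) (e3 : j + il = m) x y z,
    lie_br e1 x (lie_br ejl y z) =
    lie_br e2 (lie_br eij x y) z + (-1) ^ (i * j) *: lie_br e3 y (lie_br eil x z);
  lie_dd : forall (i j m : int) (e : i + 1 = j) (e' : j + 1 = m) x,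
    lie_d e' (lie_d e x) = 0;
  lie_leibniz : forall (i j m i1 j1 m1 : int) (e : i + j = m)
    (ei : i + 1 = i1) (ej : j + 1 = j1) (em : m + 1 = m1)
    (e1 : i1 + j = m1) (e2 : i + j1 = m1) x y,
    lie_d em (lie_br e x y) =
    lie_br e1 (lie_d ei x) y + (-1) ^ i *: lie_br e2 x (lie_d ej y)
}.

Lemma deg01 : 0 + 1 = 1 :> int. Proof. by []. Qed.
Lemma deg10 : 1 + 0 = 1 :> int. Proof. by []. Qed.
Lemma deg11 : 1 + 1 = 2 :> int. Proof. by []. Qed.
Lemma deg00 : 0 + 0 = 0 :> int. Proof. by []. Qed.

Section MaurerCartan.
Variables (k : fieldType) (L : dgla k).

Definition MC : set (L 1) :=
  [set X | lie_d L deg11 X + 2^-1 *: lie_br deg11 X X = 0].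

Definition twisted_d (X : L 1) (i j : int) (e : i + 1 = j) (x : L i) : L j :=
  lie_d L e x + lie_br (etrans (addrC 1 i) e) X x.

(* The vector field by which lam in L^0 acts on L^1. *)
Definition gauge_field (lam : L 0) (X : L 1) : L 1 :=
  lie_d L deg01 lam + lie_br deg10 X lam.

End MaurerCartan.

Record gcalg (k : fieldType) := GcAlg {
  gca_car :> int -> lmodType k;
  wedge : forall i j m : int, i + j = m -> gca_car i -> gca_car j -> gca_car m;
  wedge_linl : forall (i j m : int) (e : i + j = m) b,
    linear (fun a => wedge e a b);
  wedge_linr : forall (i j m : int) (e : i + j = m) a, linear (wedge e a);
  wedge_assoc : forall (i j l ij jl m : int) (eij : i + j = ij)
    (e1 : ij + l = m) (ejl : j + l = jl) (e2 : i + jl = m) a b c,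
    wedge e1 (wedge eij a b) c = wedge e2 a (wedge ejl b c);
  wedge_comm : forall (i j m : int) (e : i + j = m) (e' : j + i = m) a b,
    wedge e a b = (-1) ^ (i * j) *: wedge e' b a
}.

Lemma deg_predl (i j m : int) : i + j = m + 1 -> (i - 1) + j = m.
Proof. by move=> e; rewrite addrAC e addrK. Qed.

Lemma deg_predr (i j m : int) : i + j = m + 1 -> i + (j - 1) = m.
Proof. by move=> e; rewrite addrA e addrK. Qed.

Section BV.
Variables (k : fieldType) (B : gcalg k).
Variable delta : forall i j : int, j + 1 = i -> B i -> B j.

Definition bv_br (i j m : int) (e : i + j = m + 1) (a : B i) (b : B j) : B m :=
  (-1) ^ i *: (delta (erefl (m + 1)) (wedge e a b)
    - wedge (deg_predl e) (delta (subrK 1 i) a) b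
    - (-1) ^ i *: wedge (deg_predr e) a (delta (subrK 1 j) b)).

Record is_bv : Prop := IsBV {
  bv_lin : forall (i j : int) (e : j + 1 = i), linear (delta e);
  bv_dd : forall (i j m : int) (e : j + 1 = i) (e' : m + 1 = j) a,
    delta e' (delta e a) = 0;
  bv_antisym : forall (i j m : int) (e : i + j = m + 1) (e' : j + i = m + 1) a b,
    bv_br e a b = - ((-1) ^ ((i - 1) * (j - 1)) *: bv_br e' b a);
  bv_jacobi : forall (i j l ij jl il m : int)
    (ejl : j + l = jl + 1) (e1 : i + jl = m + 1)
    (eij : i + j = ij + 1) (e2 : ij + l = m + 1)
    (eil : i + l = il + 1) (e3 : j + il = m + 1) a b c,
    bv_br e1 a (bv_br ejl b c) =
    bv_br e2 (bv_br eij a b) c +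
    (-1) ^ ((i - 1) * (j - 1)) *: bv_br e3 b (bv_br eil a c);
  (* i', j', ... stand for i - 1, j - 1, ... *)
  bv_order2 : forall (i j l ij jl il t i' j' l' ij' jl' il' t' : int)
    (ei : i' + 1 = i) (ej : j' + 1 = j) (el : l' + 1 = l)
    (eij' : ij' + 1 = ij) (ejl' : jl' + 1 = jl) (eil' : il' + 1 = il)
    (et : t' + 1 = t) (eij : i + j = ij) (ejl : j + l = jl) (eil : i + l = il)
    (e1 : ij + l = t) (e2 : ij' + l = t') (e3 : i' + jl = t')
    (e4 : i + jl' = t') (e5 : j + il' = t') (e6 : j' + l = jl')
    (e7 : ij + l' = t') a b c,
    delta et (wedge e1 (wedge eij a b) c)
    - wedge e2 (delta eij' (wedge eij a b)) c
    + wedge e3 (delta ei a) (wedge ejl b c)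
    - (-1) ^ i *: wedge e4 a (delta ejl' (wedge ejl b c))
    - (-1) ^ ((i + 1) * j) *: wedge e5 b (delta eil' (wedge eil a c))
    + (-1) ^ i *: wedge e4 a (wedge e6 (delta ej b) c)
    + (-1) ^ (i + j) *: wedge e7 (wedge eij a b) (delta el c) = 0
}.

End BV.

(* The maps delta_X and rho_X are determined by non-degeneracy for X in MC(L);
   they are recorded as fields, with no condition when X is not in MC(L). *)

Record mcp (k : fieldType) := Mcp {
  mcp_L :> dgla k;
  mcp_B : gcalg k;
  pair : forall i j : int, i + 1 = j -> mcp_L i -> mcp_B j -> k;
  pair_linl : forall (i j : int) (e : i + 1 = j) b,
    linear ((fun x => pair e x b) : mcp_L i -> k^o);
  pair_linr : forall (i j : int) (e : i + 1 = j) x,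
    linear (pair e x : mcp_B j -> k^o);
  pair_ndl : forall (i j : int) (e : i + 1 = j) x,
    (forall b, pair e x b = 0) -> x = 0;
  pair_ndr : forall (i j : int) (e : i + 1 = j) b,
    (forall x, pair e x b = 0) -> b = 0;
  mcp_delta : mcp_L 1 -> forall i j : int, j + 1 = i -> mcp_B i -> mcp_B j;
  mcp_rho : mcp_L 1 -> mcp_B 1 -> mcp_L 0;
  mcp_dXX : forall X : mcp_L 1, MC X -> twisted_d X deg11 X = 0;
  mcp_deltaE : forall X : mcp_L 1, MC X ->
    forall (l i j : int) (elj : l + 1 = j) (eji : j + 1 = i) x b,
    pair eji (twisted_d X elj x) b = pair elj x (mcp_delta X eji b);
  mcp_bv : forall X : mcp_L 1, MC X -> is_bv (mcp_delta X);
  mcp_rho_lin : forall X : mcp_L 1, MC X -> linear (mcp_rho X);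
  mcp_rhoE : forall X : mcp_L 1, MC X -> forall a b : mcp_B 1,
    pair deg11 X (wedge deg11 a b) = pair deg01 (mcp_rho X a) b;
  mcp_rho_br : forall X : mcp_L 1, MC X -> exists kX : k, forall a b : mcp_B 1,
    lie_br deg00 (mcp_rho X a) (mcp_rho X b) =
    kX *: mcp_rho X (bv_br (mcp_delta X) (erefl (1 + 1)) a b)
}.

Definition nu (k : fieldType) (A : mcp k) (X : A 1) (b : mcp_B A 2) : A 1 :=
  twisted_d X deg01 (mcp_rho X (mcp_delta X deg11 b)).

Section Smooth.
Variable R : realType.

Definition basis_vec n (i : 'I_n) : 'rV[R]_n := delta_mx 0 i.

Fixpoint Ck (m n : nat) (U : set 'rV[R]_n) (f : 'rV[R]_n -> R) : Prop :=
  (forall x, U x -> {for x, continuous f}) /\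
  match m with
  | 0%N => True
  | m'.+1 => forall i : 'I_n,
      (forall x, U x -> derivable f x (basis_vec i)) /\
      Ck m' U (fun x => 'D_(basis_vec i) f x)
  end.

Definition smooth_on n (U : set 'rV[R]_n) (f : 'rV[R]_n -> R) : Prop :=
  forall m, Ck m U f.

Fixpoint iter_partial n (w : seq 'I_n) (f : 'rV[R]_n -> R) : 'rV[R]_n -> R :=
  match w with
  | [::] => f
  | i :: w' => fun x => 'D_(basis_vec i) (iter_partial w' f) x
  end.

Definition box n (u v : 'rV[R]_n) : set 'rV[R]_n :=
  [set y | forall i, u 0 i <= y 0 i <= v 0 i].

Fixpoint box_integral n :
    ('rV[R]_n -> R) -> 'rV[R]_n -> 'rV[R]_n -> R :=
  match n with
  | 0%N => fun f _ _ => f 0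
  | m.+1 => fun f (u v : 'rV[R]_(1 + m)) =>
      \int[lebesgue_measure]_(t in `[u 0 0, v 0 0])
        box_integral (fun y => f (row_mx (t%:M : 'rV[R]_1) y))
          (rsubmx u) (rsubmx v)
  end.

Variable s : scalars.
Local Notation k := (field_of R s).

Definition ksmooth_on n (U : set 'rV[R]_n) (f : 'rV[R]_n -> k) : Prop :=
  smooth_on U (@kre R s \o f) /\ smooth_on U (@kim R s \o f).

Definition kpartial n (w : seq 'I_n) (f : 'rV[R]_n -> k) (x : 'rV[R]_n) : k :=
  kmk s (iter_partial w (@kre R s \o f) x) (iter_partial w (@kim R s \o f) x).

End Smooth.

Record manifold (R : realType) := Manifold {
  mfd_car :> ptopologicalType;
  mfd_dim : nat;
  chart : Type;
  cdom : chart -> set mfd_car;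
  coord : chart -> mfd_car -> 'rV[R]_mfd_dim;
  cinv : chart -> 'rV[R]_mfd_dim -> mfd_car;
  mfd_hausdorff : hausdorff_space mfd_car;
  mfd_countable : @second_countable mfd_car;
  cdom_open : forall p, open (cdom p);
  cdom_cover : forall x, exists p, cdom p x;
  cimg_open : forall p, open (coord p @` cdom p);
  cinvK : forall p x, cdom p x -> cinv p (coord p x) = x;
  coord_cont : forall p x, cdom p x -> {for x, continuous (coord p)};
  cinv_cont : forall p y, (coord p @` cdom p) y -> {for y, continuous (cinv p)};
  chart_smooth : forall p q (i : 'I_mfd_dim),
    smooth_on (coord p @` (cdom p `&` cdom q))
      (fun y => coord q (cinv p y) 0 i)
}.

(* A volume form is given by its coefficients vol p in the charts p, which
   are multiplied by Jacobian determinants under changes of charts; vol_meas is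
   the Borel measure of integration against it (for the orientation that it
   defines), characterised by its values on coordinate boxes. *)
Record volume_form (R : realType) (M : manifold R) := VolumeForm {
  vol : chart M -> 'rV[R]_(mfd_dim M) -> R;
  vol_smooth : forall p, smooth_on (@coord _ M p @` cdom p) (vol p);
  vol_neq0 : forall p y, (@coord _ M p @` cdom p) y -> vol p y != 0;
  vol_change : forall p q y, (@coord _ M p @` (cdom p `&` cdom q)) y ->
    vol p y = vol q (coord q (cinv p y)) *
      \det (\matrix_(i, j)
        'D_(basis_vec R i) (fun z => coord q (cinv p z) 0 j) y);
  vol_meas : {measure set (g_sigma_algebraType (@open M)) -> \bar R};
  vol_measE : forall p (u v : 'rV[R]_(mfd_dim M)),
    (forall i, u 0 i <= v 0 i) -> box u v `<=` @coord _ M p @` cdom p ->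
    vol_meas (cinv p @` box u v) =
      (box_integral (fun y => `|vol p y|) u v)%:E
}.

Section Bundles.
Variables (R : realType) (s : scalars) (M : manifold R).
Local Notation k := (field_of R s).

Definition msmooth_on (W : set M) (u : M -> k) : Prop :=
  forall p : chart M,
    ksmooth_on (coord p @` (cdom p `&` W)) (fun y => u (cinv p y)).

Definition vol_integral (mu : volume_form M) (u : M -> k) : k :=
  kmk s (\int[vol_meas mu]_(x in setT) kre (u x))
        (\int[vol_meas mu]_(x in setT) kim (u x)).

Record vbundle := VBundle {
  fiber :> M -> lmodType k;
  triv : Type;
  tdom : triv -> set M;
  trank : triv -> nat;
  tmap : forall (q : triv) (x : M), {linear fiber x -> 'rV[k]_(trank q)};
  tinv : forall (q : triv) (x : M), 'rV[k]_(trank q) -> fiber x;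
  tdom_open : forall q, open (tdom q);
  tdom_cover : forall x, exists q, tdom q x;
  tmapK : forall q x, tdom q x -> cancel (tmap q x) (@tinv q x);
  tinvK : forall q x, tdom q x -> cancel (@tinv q x) (tmap q x);
  triv_smooth : forall q q' (v : 'rV[k]_(trank q)) (l : 'I_(trank q')),
    msmooth_on (tdom q `&` tdom q') (fun x => tmap q' x (@tinv q x v) 0 l)
}.

#[global] Arguments tinv {E} q x v : rename.

Definition smooth_section (E : vbundle) (sigma : forall x, E x) : Prop :=
  forall (q : triv E) (l : 'I_(trank q)),
    msmooth_on (tdom q) (fun x => tmap q x (sigma x) 0 l).

(* An identification of the vector space V with Gamma(E). *)
Record sections_of (V : lmodType k) (E : vbundle) := SectionsOf {
  sec :> forall x : M, {linear V -> E x};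
  sec_inj : forall v, (forall x, sec x v = 0) -> v = 0;
  sec_smooth : forall v, smooth_section (fun x => sec x v);
  sec_surj : forall sigma : (forall x, E x), smooth_section sigma ->
    exists v, forall x, sec x v = sigma x
}.

#[global] Arguments sec {V E} s x : rename.

(* A smooth, fibrewise perfect pairing, that is, an identification of E' with
   the dual bundle of E; the fibres have finite dimension. *)
Record duality (E E' : vbundle) := Duality {
  dual_pair : forall x : M, E x -> E' x -> k;
  dual_linl : forall x b,
    linear ((fun a => @dual_pair x a b) : E x -> k^o);
  dual_linr : forall x a, linear (@dual_pair x a : E' x -> k^o);
  dual_ndl : forall x a, (forall b, @dual_pair x a b = 0) -> a = 0;
  dual_ndr : forall x b, (forall a, @dual_pair x a b = 0) -> b = 0;
  dual_smooth : forall (q : triv E) (q' : triv E')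
    (v : 'rV[k]_(trank q)) (v' : 'rV[k]_(trank q')),
    msmooth_on (tdom q `&` tdom q')
      (fun x => @dual_pair x (tinv q x v) (tinv q' x v'))
}.

#[global] Arguments dual_pair {E E'} d x a b : rename.

(* Words of length at most r in the coordinate directions; they index the
   partial derivatives of order at most r. *)
Definition jet_index (r : nat) :=
  {m : 'I_r.+1 & m.-tuple 'I_(mfd_dim M)}.

(* The partial derivative, in the chart p at the point x, of the l-th component
   of the section v in the trivialisation q. *)
Definition jet_coord (V : lmodType k) (E : vbundle) (S : sections_of V E)
    (p : chart M) (q : triv E) (r : nat) (x : M) (v : V)
    (w : jet_index r) (l : 'I_(trank q)) : k :=
  kpartial (tagged w)
    (fun y => tmap q (cinv p y) (S (cinv p y) v) 0 l) (coord p x).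

Definition is_diffop (V V' : lmodType k) (E E' : vbundle)
    (S : sections_of V E) (S' : sections_of V' E') (P : V -> V') : Prop :=
  exists r : nat, forall (p : chart M) (q : triv E) (q' : triv E'),
    let W := cdom p `&` tdom q `&` tdom q' in
    exists2 c : jet_index r -> 'I_(trank q) -> 'I_(trank q') -> M -> k,
      (forall w l l', msmooth_on W (c w l l')) &
      forall v x l', W x ->
        tmap q' x (S' x (P v)) 0 l' =
        \sum_w \sum_l c w l l' x * jet_coord S p x v w l.

(* Functions of a point of R^n and of finitely many scalars, indexed by a
   finite type J, are seen as functions of real variables in order to express
   their smoothness. *)
Definition realify n (J : finType) (F : 'rV[R]_n -> (J -> k) -> k)
    (v : 'rV[R]_(n + (#|J| + #|J|))) : k :=
  F (lsubmx v) (fun j => kmk s (lsubmx (rsubmx v) 0 (enum_rank j))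
                               (rsubmx (rsubmx v) 0 (enum_rank j))).

(* Phi v x = F (j_r v (x)) for a smooth function F on the bundle of r-jets of
   sections of E: in the coordinates given by a chart and a trivialisation,
   Phi v x is a smooth function of the position and of the partial
   derivatives of order at most r. *)
Definition is_lagrangian (V : lmodType k) (E : vbundle) (S : sections_of V E)
    (r : nat) (Phi : V -> M -> k) : Prop :=
  forall (p : chart M) (q : triv E),
    let W := cdom p `&` tdom q in
    exists2 F : 'rV[R]_(mfd_dim M) ->
                (jet_index r * 'I_(trank q) -> k) -> k,
      ksmooth_on [set v | (coord p @` W) (lsubmx v)] (realify F) &
      forall v x, W x ->
        Phi v x = F (coord p x) (fun j => jet_coord S p x v j.1 j.2).

End Bundles.

Section Settings.
Variables (R : realType) (s : scalars).
Local Notation k := (field_of R s).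
Variable A : mcp k.
Local Notation B := (mcp_B A).

Definition finite_dim (V : lmodType k) : Prop :=
  exists (n : nat) (phi : {linear V -> 'rV[k]_n}), bijective phi.

Definition total_finite_dim : Prop :=
  (forall i, finite_dim (A i)) /\
  exists N : int, forall i, N < `|i| -> forall x : A i, x = 0.

Definition fd_curve (c c' : R -> A 1) (a b : R) : Prop :=
  forall t, a < t < b -> forall phi : {linear A 1 -> k^o},
    has_deriv (fun u => phi (c u) : k) t (phi (c' t)).

Definition fd_smooth (f : A 1 -> k) : Prop :=
  forall n (v : 'I_n -> A 1),
    ksmooth_on setT
      (fun t : 'rV[R]_n => f (\sum_j kreal s (t 0 j) *: v j)).

(* M is compact, because the pairing is an integral over M that is defined on
   all smooth sections. *)

Record bundle_data := BundleData {
  bd_M : manifold R;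
  bd_compact : compact [set: bd_M];
  bd_mu : volume_form bd_M;
  bd_E : int -> vbundle s bd_M;
  bd_E' : int -> vbundle s bd_M;
  bd_dual : forall i j : int, i + 1 = j -> duality (bd_E i) (bd_E' j);
  bd_L : forall i, sections_of (A i) (bd_E i);
  bd_B : forall i, sections_of (B i) (bd_E' i);
  bd_sign : int -> bool;
  bd_pairE : forall (i j : int) (e : i + 1 = j) x b,
    pair e x b = (-1) ^+ bd_sign i *
      vol_integral bd_mu (fun p => dual_pair (bd_dual e) p (bd_L i p x) (bd_B j p b));
  bd_wedge_fib : forall (i j m : int) (e : i + j = m) (p : bd_M) a a' b b',
    bd_B i p a = bd_B i p a' -> bd_B j p b = bd_B j p b' ->
    bd_B m p (wedge e a b) = bd_B m p (wedge e a' b');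
  bd_rho_fib : forall X : A 1, MC X -> forall (p : bd_M) a a',
    bd_B 1 p a = bd_B 1 p a' ->
    bd_L 0 p (mcp_rho X a) = bd_L 0 p (mcp_rho X a');
  bd_d_diffop : forall X : A 1, MC X -> forall (i j : int) (e : i + 1 = j),
    is_diffop (bd_L i) (bd_L j) (twisted_d X e);
  bd_delta_diffop : forall X : A 1, MC X -> forall (i j : int) (e : j + 1 = i),
    is_diffop (bd_B i) (bd_B j) (mcp_delta X e)
}.

(* c is a smooth one-parameter family of sections for a < t < b, with
   velocity c'. *)
Definition bundle_curve (D : bundle_data) (c c' : R -> A 1) (a b : R) : Prop :=
  (forall (p : chart (bd_M D)) (q : triv (bd_E D 1)) (l : 'I_(trank q)),
    ksmooth_on [set v : 'rV[R]_(1 + mfd_dim (bd_M D)) |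
        a < lsubmx v 0 0 < b /\
        (coord p @` (cdom p `&` tdom q)) (rsubmx v)]
      (fun v => let x := cinv p (rsubmx v) in
        tmap q x (bd_L D 1 x (c (lsubmx v 0 0))) 0 l)) /\
  (forall t, a < t < b -> forall (q : triv (bd_E D 1)) x (l : 'I_(trank q)),
    tdom q x ->
    has_deriv (fun u => tmap q x (bd_L D 1 x (c u)) 0 l) t
      (tmap q x (bd_L D 1 x (c' t)) 0 l)).

Definition local_functional (D : bundle_data) (f : A 1 -> k) : Prop :=
  exists r (Phi : A 1 -> bd_M D -> k),
    is_lagrangian (bd_L D 1) r Phi /\
    forall X, f X = vol_integral (bd_mu D) (Phi X).

(* Y is obtained from X by the time-one flow of the gauge field of lam. *)
Definition gauge_by (curve : (R -> A 1) -> (R -> A 1) -> R -> R -> Prop)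
    (lam : A 0) (X Y : A 1) : Prop :=
  exists c a b, [/\ a < 0, 1 < b,
    curve c (fun t => gauge_field lam (c t)) a b, c 0 = X & c 1 = Y].

Definition gauge_exists (D : bundle_data) : Prop :=
  forall lam : A 0, exists2 eps : k, eps != 0 &
    forall X, MC X -> exists Y, gauge_by (bundle_curve D) (eps *: lam) X Y.

Inductive setting :=
  | FiniteDimensional of total_finite_dim
  | VectorBundles (D : bundle_data) of gauge_exists D.

Variable S : setting.

Definition curve : (R -> A 1) -> (R -> A 1) -> R -> R -> Prop :=
  match S with
  | FiniteDimensional _ => fd_curve
  | VectorBundles D _ => bundle_curve D
  end.

Definition functional : (A 1 -> k) -> Prop :=
  match S with
  | FiniteDimensional _ => fd_smooth
  | VectorBundles D _ => local_functional D
  end.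

Definition gauge_equiv : A 1 -> A 1 -> Prop :=
  clos_refl_sym_trans (A 1) (fun X Y => exists lam, gauge_by curve lam X Y).

Definition gauge_orbits (O : set (A 1)) : Prop :=
  O `<=` @MC k A /\ forall X Y, O X -> gauge_equiv X Y -> O Y.

(* b represents the derivative of f at X: d/dt f(X(t)) = (X', b) for every
   curve X(t) through X. *)
Definition is_derivative (f : A 1 -> k) (X : A 1) (b : B 2) : Prop :=
  forall c c' (lo hi t : R), curve c c' lo hi -> lo < t < hi -> c t = X ->
    has_deriv (fun u => f (c u)) t (pair deg11 (c' t) b).

Definition D (f : A 1 -> k) (X : A 1) : B 2 := xget 0 (is_derivative f X).

(* The derivative must be represented in B^2; over C, this is where
   holomorphy comes in, as smoothness is meant over R. *)
Definition observable (f : A 1 -> k) : Prop :=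
  functional f /\ forall X, exists b, is_derivative f X b.

(* The coset f + I, where I consists of the observables vanishing on O. *)
Definition class (O : set (A 1)) (f : A 1 -> k) : set (A 1 -> k) :=
  [set h | observable h /\ forall X, O X -> h X = f X].

Definition R_O (O : set (A 1)) : set (set (A 1 -> k)) :=
  [set class O f | f in observable].

Definition representative (F : set (A 1 -> k)) : A 1 -> k := xget (fun=> 0) F.

Definition poisson (F G : set (A 1 -> k)) (X : A 1) : k :=
  pair deg11 X (wedge deg11
    (mcp_delta X deg11 (D (representative F) X))
    (mcp_delta X deg11 (D (representative G) X))).

(* At time t, every class G in R_O evolves along the curve c (which lies in O)
   by dG/dt = {F, G}. *)
Definition hamiltonian_evolution (O : set (A 1)) (F : set (A 1 -> k))
    (c : R -> A 1) (t : R) : Prop :=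
  forall G, R_O O G ->
    has_deriv (fun u => representative G (c u)) t (poisson F G (c t)).

End Settings.

(* Main.v *)
(* For observables f and g, the definitions of rho_X and delta_X give
     {[f], [g]}(X) = (rho_X delta_X Df, delta_X Dg) = (nu_X Df, Dg),
   whereas d/dt g(X(t)) = (X', Dg).  Hence the equation X' = nu_X Df implies the
   hamiltonian evolution of all classes, and the converse follows once every b
   in B^2 is the derivative of some observable.  The function X |-> (X, b) is
   such an observable; in the bundle setting it is a local functional of order
   0, and it may be differentiated under the integral because M is compact.
   Independence of representatives: if h vanishes on O, then h is constant along
   the gauge flow of each lam in L^0, so (d_X lam, Dh) = (lam, delta_X Dh) = 0
   and delta_X Dh = 0 by non-degeneracy.  The gauge flow exists by hypothesis in
   the bundle setting; in finite dimension the gauge field is affine in X and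
   the flow is given by an exponential series. *)
From HB Require Import structures.
Require Import Defs.
From mathcomp Require Import all_boot all_order all_algebra.
From mathcomp Require Import all_classical all_reals all_analysis.
Set Implicit Arguments.
Unset Strict Implicit.
Unset Printing Implicit Defensive.
Import Order.TTheory GRing.Theory Num.Theory.
Import numFieldNormedType.Exports.
Local Open Scope classical_set_scope.
Local Open Scope ring_scope.

(** * Real and imaginary parts, and derivatives of scalar functions of a real variable *)

Section ScalarTheory.
Variables (R : realType) (s : scalars).
Local Notation k := (field_of R s).
Implicit Types x y : k.

Lemma kmkK x : kmk s (kre x) (kim x) = x.
Proof. by case: s x => //= -[]. Qed.

Lemma kre_mk (a b : R) : kre (kmk s a b) = a.
Proof. by case: s. Qed.

Lemma kre_real (a : R) : kre (kreal s a) = a.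
Proof. by rewrite kre_mk. Qed.

Lemma kim_real (a : R) : kim (kreal s a) = 0.
Proof. by case: s. Qed.

Lemma kre0 : kre (0 : k) = 0.
Proof. by case: s. Qed.

Lemma kim0 : kim (0 : k) = 0.
Proof. by case: s. Qed.

Lemma kreD x y : kre (x + y) = kre x + kre y.
Proof. by case: s x y => //= -[a b] [a' b']. Qed.

Lemma kimD x y : kim (x + y) = kim x + kim y.
Proof. by case: s x y => /= [x y|[a b] [a' b']] //; rewrite addr0. Qed.

Lemma kreM x y : kre (x * y) = kre x * kre y - kim x * kim y.
Proof. by case: s x y => /= [x y|[a b] [a' b']] //; rewrite mul0r subr0. Qed.

Lemma kimM x y : kim (x * y) = kre x * kim y + kim x * kre y.
Proof.
by case: s x y => /= [x y|[a b] [a' b']] //; rewrite mulr0 mul0r addr0.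
Qed.

Lemma kre_sum (I : Type) (r : seq I) (F : I -> k) :
  kre (\sum_(i <- r) F i) = \sum_(i <- r) kre (F i).
Proof. by elim/big_rec2: _ => [|i u v _ <-]; rewrite ?kre0 ?kreD. Qed.

Lemma kim_sum (I : Type) (r : seq I) (F : I -> k) :
  kim (\sum_(i <- r) F i) = \sum_(i <- r) kim (F i).
Proof. by elim/big_rec2: _ => [|i u v _ <-]; rewrite ?kim0 ?kimD. Qed.

Lemma k_ext x y : kre x = kre y -> kim x = kim y -> x = y.
Proof. by move=> e1 e2; rewrite -[x]kmkK e1 e2 kmkK. Qed.

Implicit Types (u w : R -> k) (t : R).

Lemma has_deriv_unique u t x y : has_deriv u t x -> has_deriv u t y -> x = y.
Proof.
move=> [a1 a2] [b1 b2]; apply: k_ext.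
  by rewrite -(@derive_val _ _ _ _ _ _ _ a1) (@derive_val _ _ _ _ _ _ _ b1).
by rewrite -(@derive_val _ _ _ _ _ _ _ a2) (@derive_val _ _ _ _ _ _ _ b2).
Qed.

Lemma has_deriv_near u w t x : {near t, u =1 w} -> has_deriv u t x ->
  has_deriv w t x.
Proof.
move=> e [h1 h2]; split.
  apply: near_eq_is_derive h1.
  by apply: filterS e => z /= ->.
apply: near_eq_is_derive h2.
by apply: filterS e => z /= ->.
Qed.

Lemma has_deriv_cst x t : has_deriv (fun=> x) t 0.
Proof. by rewrite /has_deriv kre0 kim0; split; exact: is_derive_cst. Qed.

Lemma has_derivD u w t x y : has_deriv u t x -> has_deriv w t y ->
  has_deriv (fun r => u r + w r) t (x + y).
Proof.
move=> [a1 a2] [b1 b2]; split; rewrite ?kreD ?kimD.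
  rewrite (_ : _ \o _ = (@kre R s \o u) + (@kre R s \o w)).
    exact: is_deriveD.
  by apply/funext => z /=; rewrite kreD.
rewrite (_ : _ \o _ = (@kim R s \o u) + (@kim R s \o w)).
  exact: is_deriveD.
by apply/funext => z /=; rewrite kimD.
Qed.

Lemma has_derivMl u t x y : has_deriv u t x ->
  has_deriv (fun r => y * u r) t (y * x).
Proof.
move=> [a1 a2]; split.
  rewrite (_ : _ \o _ = kre y \*: (@kre R s \o u) - kim y \*: (@kim R s \o u)).
    by rewrite kreM; apply: is_deriveB.
  by apply/funext => z /=; rewrite kreM.
rewrite (_ : _ \o _ = kre y \*: (@kim R s \o u) + kim y \*: (@kre R s \o u)).
  by rewrite kimM; apply: is_deriveD.
by apply/funext => z /=; rewrite kimM.
Qed.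

Lemma has_deriv_sum (I : Type) (r : seq I) (F : I -> R -> k) t (d : I -> k) :
  (forall i, has_deriv (F i) t (d i)) ->
  has_deriv (fun z => \sum_(i <- r) F i z) t (\sum_(i <- r) d i).
Proof.
move=> h; elim: r => [|i r ih].
  rewrite big_nil (_ : (fun z => _) = fun=> 0); first exact: has_deriv_cst.
  by apply/funext => z; rewrite big_nil.
rewrite big_cons (_ : (fun z => _) = fun z => F i z + \sum_(j <- r) F j z).
  exact: has_derivD.
by apply/funext => z; rewrite big_cons.
Qed.

Lemma is_derive_scale (g : R -> R) (c t dg : R) :
  is_derive (c * t) 1 g dg -> is_derive t 1 (fun r => g (c * r)) (c * dg).
Proof.
move=> h.
have e : is_derive t 1 (fun r : R => c * r) c.
  rewrite (_ : (fun r : R => _) = c \*: id) //.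
  have := @is_deriveZ _ _ _ id c t 1 1 _.
  by rewrite /GRing.scale /= mulr1; apply.
by have := @is_derive1_comp _ g (fun r => c * r) t dg c h e; rewrite mulrC.
Qed.

Lemma has_deriv_scale u c t x : has_deriv u (c * t) x ->
  has_deriv (fun r => u (c * r)) t (kreal s c * x).
Proof.
move=> [h1 h2].
split; rewrite ?kreM ?kimM kre_real kim_real mul0r ?subr0 ?addr0.
  exact: (@is_derive_scale (@kre R s \o u)).
exact: (@is_derive_scale (@kim R s \o u)).
Qed.

Lemma has_deriv_kmk (u w : R -> R) (t a a' : R) :
  is_derive t 1 u a -> is_derive t 1 w a' ->
  has_deriv (fun r => kmk s (u r) (w r)) t (kmk s a a').
Proof. by case: s => hu hw; split=> //; exact: is_derive_cst. Qed.

End ScalarTheory.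

(** * Gauge invariance and the Poisson bracket *)

Section Pairing.
Variables (k : fieldType) (A : mcp k).

Lemma pairZl (i j : int) (e : i + 1 = j) (a : k) (x : A i) b :
  pair e (a *: x) b = a * pair e x b.
Proof. exact: (scalable_linear (pair_linl e b)). Qed.

Lemma pairBl (i j : int) (e : i + 1 = j) (x y : A i) b :
  pair e (x - y) b = pair e x b - pair e y b.
Proof. exact: (zmod_morphism_linear (pair_linl e b)). Qed.

Lemma pairDl (i j : int) (e : i + 1 = j) (x y : A i) b :
  pair e (x + y) b = pair e x b + pair e y b.
Proof. by have := pair_linl e b 1 x y; rewrite !scale1r. Qed.

Lemma pairZr (i j : int) (e : i + 1 = j) (a : k) (x : A i) b :
  pair e x (a *: b) = a * pair e x b.
Proof. exact: (scalable_linear (pair_linr e x)). Qed.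

Lemma pairBr (i j : int) (e : i + 1 = j) (x : A i) b b' :
  pair e x (b - b') = pair e x b - pair e x b'.
Proof. exact: (zmod_morphism_linear (pair_linr e x)). Qed.

Lemma gauge_fieldE (lam : A 0) (X : A 1) :
  gauge_field lam X = twisted_d X deg01 lam.
Proof.
(* The two sides carry different proofs of [1 + 0 = 1], which are equal because equality on [int] is
   decidable. *)
by rewrite /twisted_d (eq_irrelevance (etrans _ _) deg10).
Qed.

Lemma gauge_fieldZ (a : k) (lam : A 0) (X : A 1) :
  gauge_field (a *: lam) X = a *: gauge_field lam X.
Proof.
rewrite /gauge_field linearZ scalerDr; congr (_ + _).
exact: (scalable_linear (lie_br_linr deg10 X)).
Qed.

End Pairing.

Section Core.
Variables (R : realType) (s : scalars) (A : mcp (field_of R s)).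
Variable S : setting A.
Local Notation k := (field_of R s).

(** The two settings enter the core argument only through this hypothesis and the next two; each is
    proved below for both settings. *)
Hypothesis curve_scale : forall (c c' : R -> A 1) (a b r a' b' : R),
  curve S c c' a b -> (forall u, a' < u < b' -> a < r * u < b) ->
  curve S (fun u => c (r * u)) (fun u => kreal s r *: c' (r * u)) a' b'.

Hypothesis gauge_flow : forall (X : A 1) (lam : A 0), MC X ->
  exists2 eps : k, eps != 0 & exists Y, gauge_by (curve S) (eps *: lam) X Y.

Hypothesis linear_observable : forall b : mcp_B A 2,
  exists2 g, observable S g & forall X, is_derivative S g X b.

(* The time-one flow of u *: lam is the time-u flow of lam. *)
Lemma gauge_equiv_flow (c : R -> A 1) (lam : A 0) (a b : R) :
  a < 0 -> 1 < b -> curve S c (fun t => gauge_field lam (c t)) a b ->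
  \forall u \near (0 : R), gauge_equiv S (c 0) (c u).
Proof.
move=> a0 b1 cc.
have b0 : 0 < b by rewrite (lt_trans _ b1).
(* The rescaled curve is taken on []-1, 2[], an open interval around [[0, 1]] as [gauge_by]
   requires. There [|u * w| <= 2 * |u|], which has to stay below both [- a] and [b]; hence the
   half. *)
have m0 : 0 < Num.min (- a) b / 2 by rewrite divr_gt0// lt_min oppr_gt0 a0.
near=> u.
have : `|u| < Num.min (- a) b / 2.
  by near: u; exact: (@nbhs0_lt R R^o).
rewrite ltr_pdivlMr// lt_min => /andP[ua ub].
have bd w : -1 < w < 2 -> a < u * w < b.
  move=> /andP[w1 w2].
  have : `|u * w| <= `|u| * 2.
    rewrite normrM ler_wpM2l// ler_norml (ltW w2) andbT.
    by rewrite (le_trans _ (ltW w1))// lerN2 ler1n.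
  rewrite ler_norml => /andP[h1 h2]; apply/andP; split.
    by apply: lt_le_trans h1; rewrite ltrNr.
  exact: le_lt_trans ub.
apply: Relation_Operators.rst_step; exists (kreal s u *: lam).
exists (fun w => c (u * w)), (-1), 2.
split; rewrite ?mulr0 ?mulr1 ?ltr1n ?ltrN10//.
have := curve_scale cc bd; congr curve; apply/funext => w.
by rewrite gauge_fieldZ.
Unshelve. all: by end_near. Qed.

Variable O : set (A 1).
Hypothesis gO : gauge_orbits S O.

(* The gauge flow through X stays in O, so f and g agree along it. *)
Lemma derivative_gauge (f g : A 1 -> k) (X : A 1) (bf bg : mcp_B A 2) lam :
  O X -> (forall Y, O Y -> f Y = g Y) ->
  is_derivative S f X bf -> is_derivative S g X bg ->
  pair deg11 (twisted_d X deg01 lam) bf = pair deg11 (twisted_d X deg01 lam) bg.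
Proof.
move=> OX fg df dg; have [OMC Oinv] := gO.
have [eps eps0 [Y [c [a [b [a0 b1 cc c0 _]]]]]] := gauge_flow lam (OMC _ OX).
have z : a < 0 < b by rewrite a0 (lt_trans _ b1).
have /= h1 := df _ _ _ _ _ cc z c0; have /= h2 := dg _ _ _ _ _ cc z c0.
have h : {near (0 : R), (fun u => f (c u)) =1 (fun u => g (c u))}.
  apply: filterS (gauge_equiv_flow a0 b1 cc) => u /= Xu.
  by apply/fg/Oinv/Xu; rewrite c0.
have := has_deriv_unique (has_deriv_near h h1) h2.
(* The gauge field is linear in [lam], so both derivatives carry the factor [eps], which is nonzero
   and cancels. *)
rewrite c0 gauge_fieldZ gauge_fieldE !pairZl.
exact: mulfI.
Qed.

(** By adjointness, pairing [delta_X bf] with [x] in [L^0] is pairing [bf] with the gauge direction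
    [d_X x], where [bf] and [bg] agree; non-degeneracy concludes. This makes the bracket independent
    of representatives. *)
Lemma delta_derivative_eq (f g : A 1 -> k) (X : A 1) (bf bg : mcp_B A 2) :
  O X -> (forall Y, O Y -> f Y = g Y) ->
  is_derivative S f X bf -> is_derivative S g X bg ->
  mcp_delta X deg11 bf = mcp_delta X deg11 bg.
Proof.
move=> OX fg df dg; apply/eqP; rewrite -subr_eq0; apply/eqP.
apply: (@pair_ndr _ A _ _ deg01) => x.
have mX := gO.1 _ OX.
rewrite pairBr -!(mcp_deltaE mX deg01 deg11).
by rewrite (derivative_gauge x OX fg df dg) subrr.
Qed.

Lemma observable_derivative (f : A 1 -> k) X :
  observable S f -> is_derivative S f X (D S f X).
Proof. by move=> [_ /(_ X) [b fb]]; exact: (xgetPex 0 (ex_intro _ b fb)). Qed.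

Lemma representative_class (f : A 1 -> k) : observable S f ->
  class S O f (representative (class S O f)).
Proof. by move=> of_; apply: xgetPex; exists f; split. Qed.

(** The chosen representative of the class of [f] is exchanged for [f] itself, since it enters only
    through [delta_X]. That of [g] is kept, because the evolution of a class is measured on its
    chosen representative. *)
Lemma poissonE (f g : A 1 -> k) X : observable S f -> observable S g -> O X ->
  poisson S (class S O f) (class S O g) X =
  pair deg11 (nu X (D S f X)) (D S (representative (class S O g)) X).
Proof.
move=> of_ og OX; have mX := gO.1 _ OX.
have [of' ff'] := representative_class of_.
rewrite /poisson mcp_rhoE// /nu mcp_deltaE//; congr (pair _ (mcp_rho X _) _).
apply: (delta_derivative_eq OX ff'); exact: observable_derivative.
Qed.

Lemma hamiltonian_evolutionP (f : A 1 -> k) (c c' : R -> A 1) (a b t : R) :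
  observable S f -> curve S c c' a b -> (forall u, a < u < b -> O (c u)) ->
  a < t < b ->
  hamiltonian_evolution S O (class S O f) c t <->
  c' t = nu (c t) (D S f (c t)).
Proof.
move=> of_ cc cO tab; split=> [h|e].
  apply/eqP; rewrite -subr_eq0; apply/eqP.
  apply: (@pair_ndl _ A _ _ deg11) => d.
  (* Testing [c' t - nu] against every [d] in [B^2] suffices by non-degeneracy; the evolution of the
     observable with constant derivative [d] provides the test. *)
  have [g og dg] := linear_observable d.
  have hg := h (class S O g) (ex_intro2 _ _ g og erefl).
  have [og' gg'] := representative_class og.
  rewrite poissonE// in hg; last exact: cO.
  have dg' := @observable_derivative _ (c t) og'.
  (* The values of [nu] are gauge directions, so the derivative of the representative may be
     replaced by [d] there, although the two can differ in other directions. *)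
  rewrite (derivative_gauge _ (cO _ tab) gg' dg' (dg _)) in hg.
  rewrite pairBl; apply/eqP; rewrite subr_eq0; apply/eqP.
  apply: has_deriv_unique hg.
  apply: has_deriv_near (dg _ _ _ _ _ _ cc tab erefl).
  (* The representative and [g] agree on [O], where the curve stays for all times in []a, b[], hence
     near [t]. *)
  near=> u; apply/esym/gg'/cO; near: u.
  by apply: (@near_in_itvoo _ a b); rewrite in_itv.
move=> _ [g og <-]; rewrite poissonE//; last exact: cO.
rewrite -e; have [og' _] := representative_class og.
exact: (@observable_derivative _ (c t) og') cc tab erefl.
Unshelve. all: by end_near. Qed.

End Core.

(** * Smooth functions *)

Section DirectionalDerivative.
Variables (R : realType) (V : normedModType R).
Implicit Types (f : V -> R) (x v : V).

(** Both sides are limits of the same difference quotient; directional derivatives thus reduce to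
    functions of one real variable. *)
Lemma is_derive_line f x v (d : R) :
  is_derive x v f d <-> is_derive (0 : R) 1 (fun h : R => f (h *: v + x)) d.
Proof.
have e : (fun h : R => h^-1 *: (((fun h : R => f (h *: v + x)) \o shift 0)
    (h *: 1) - (fun h : R => f (h *: v + x)) 0)) =
  (fun h : R => h^-1 *: ((f \o shift x) (h *: v) - f x)).
  apply/funext => h /=.
  by rewrite addr0 scale0r add0r /GRing.scale /= mulr1.
have ed : derivable f x v <->
    derivable (fun h : R => f (h *: v + x)) 0 1.
  by rewrite /derivable e.
have ee : 'D_v f x = 'D_1 (fun h : R => f (h *: v + x)) 0.
  by rewrite /derive e.
by split=> -[h1 h2]; apply: DeriveDef; rewrite -?h2 -?ee//; apply/ed.
Qed.

Lemma is_derive_dirZ f x v (c d : R) :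
  is_derive x v f d -> is_derive x (c *: v) f (c * d).
Proof.
move=> /is_derive_line h; apply/is_derive_line.
have := @is_derive_scale _ _ c 0 d; rewrite mulr0 => /(_ _ h).
by under eq_fun do rewrite mulrC -scalerA.
Qed.

End DirectionalDerivative.

Section CkTheory.
Variable R : realType.

Lemma near_continuous (T U : topologicalType) (f g : T -> U) (x : T) :
  {near x, f =1 g} -> {for x, continuous f} -> {for x, continuous g}.
Proof.
move=> e; have e' : f x = g x := nbhs_singleton e.
rewrite /prop_for /continuous_at e'; apply: cvg_trans; apply: near_eq_cvg.
by apply: filterS e => y /= ->.
Qed.

Lemma Ck_near n m (U : set 'rV[R]_n) (f g : 'rV[R]_n -> R) :
  (forall x, U x -> {near x, f =1 g}) -> Ck m U f -> Ck m U g.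
Proof.
elim: m f g => [|m ih] f g fg [cf df].
  by split=> // x Ux; exact: near_continuous (fg _ Ux) (cf _ Ux).
split=> [x Ux|i]; first exact: near_continuous (fg _ Ux) (cf _ Ux).
have [df1 df2] := df i; split=> [x Ux|].
  exact: near_eq_derivable (fg _ Ux) (df1 _ Ux).
(* Agreement near [x] is agreement near every point close to [x], so the partial derivatives also
   agree near [x]. *)
apply: ih df2 => x Ux; have := nbhs_interior (fg _ Ux).
by apply: filterS => y /= e; exact: near_eq_derive.
Qed.

Lemma Ck_eq n m (U : set 'rV[R]_n) (f g : 'rV[R]_n -> R) : open U ->
  {in U, f =1 g} -> Ck m U f -> Ck m U g.
Proof.
move=> oU e; apply: Ck_near => x Ux.
by apply: filterS (open_nbhs_nbhs (conj oU Ux)) => y Uy; apply: e; rewrite inE.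
Qed.

Lemma Ck_weaken n m (U : set 'rV[R]_n) (f : 'rV[R]_n -> R) :
  Ck m.+1 U f -> Ck m U f.
Proof.
elim: m f => [|m ih] f [cf df]; split=> // i.
by have [df1 df2] := df i; split=> //; exact: ih.
Qed.

(** Each condition in [Ck] concerns [f] or an iterated partial derivative at a single point of the
    set, with derivatives taken in the whole space. *)
Lemma Ck_local n m (U : set 'rV[R]_n) (f : 'rV[R]_n -> R) :
  (forall x, U x -> exists2 W : set 'rV[R]_n, W x & Ck m W f) -> Ck m U f.
Proof.
elim: m f => [|m ih] f h.
  by split=> // x Ux; have [W Wx [cf _]] := h _ Ux; exact: cf.
split=> [x Ux|i]; first by have [W Wx [cf _]] := h _ Ux; exact: cf.
split=> [x Ux|]; first by have [W Wx [_ /(_ i) [df _]]] := h _ Ux; exact: df.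
by apply: ih => x Ux; have [W Wx [_ /(_ i) [_ df]]] := h _ Ux; exists W.
Qed.

Lemma Ck_sub n m (U W : set 'rV[R]_n) (f : 'rV[R]_n -> R) :
  W `<=` U -> Ck m U f -> Ck m W f.
Proof. by move=> WU h; apply: Ck_local => x Wx; exists U => //; exact: WU. Qed.

Lemma Ck_cst n m (U : set 'rV[R]_n) (a : R) : Ck m U (fun=> a).
Proof.
elim: m a => [|m ih] a; split=> //; try by move=> x _; exact: cst_continuous.
move=> i; split=> [x _|]; first exact: derivable_cst.
rewrite (_ : 'D_(basis_vec R i) (fun=> a) = fun=> 0); first exact: ih.
by apply/funext => x; exact: derive_cst.
Qed.

Lemma CkD n m (U : set 'rV[R]_n) (f g : 'rV[R]_n -> R) : open U ->
  Ck m U f -> Ck m U g -> Ck m U (fun x => f x + g x).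
Proof.
move=> oU; elim: m f g => [|m ih] f g [cf df] [cg dg].
  by split=> // x Ux; exact: cvgD (cf _ Ux) (cg _ Ux).
split=> [x Ux|i]; first by exact: cvgD (cf _ Ux) (cg _ Ux).
have [df1 df2] := df i; have [dg1 dg2] := dg i; split=> [x Ux|].
  by apply: derivableD; [exact: df1|exact: dg1].
apply: Ck_eq (ih _ _ df2 dg2) => // x /set_mem Ux.
by rewrite -deriveD//; [exact: df1|exact: dg1].
Qed.

Lemma CkM n m (U : set 'rV[R]_n) (f g : 'rV[R]_n -> R) : open U ->
  Ck m U f -> Ck m U g -> Ck m U (fun x => f x * g x).
Proof.
move=> oU; elim: m f g => [|m ih] f g hf hg.
  case: hf hg => [cf _] [cg _]; split=> // x Ux.
  exact: cvgM (cf _ Ux) (cg _ Ux).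
have [cf df] := hf; have [cg dg] := hg.
split=> [x Ux|i]; first by exact: cvgM (cf _ Ux) (cg _ Ux).
have [df1 df2] := df i; have [dg1 dg2] := dg i; split=> [x Ux|].
  by apply: derivableM; [exact: df1|exact: dg1].
have h := CkD oU (ih _ _ (Ck_weaken hf) dg2) (ih _ _ (Ck_weaken hg) df2).
apply: Ck_eq h => // x /set_mem Ux.
by rewrite [RHS]deriveM//; [exact: df1|exact: dg1].
Qed.

Lemma Ck_coord n m (U : set 'rV[R]_n) (j : 'I_n) : Ck m U (fun x => x 0 j).
Proof.
have d x i : is_derive x (basis_vec R i) (fun x : 'rV[R]_n => x 0 j)
    (basis_vec R i 0 j).
  apply/is_derive_line.
  rewrite (_ : (fun h : R => _) = basis_vec R i 0 j \*: id + cst (x 0 j)).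
    by apply: is_derive_eq; rewrite addr0 /GRing.scale /= mulr1.
  by apply/funext => h; rewrite !mxE !fctE /GRing.scale /= mulrC.
case: m => [|m]; split=> //; try by move=> x _; exact: coord_continuous.
move=> i; split=> [x _|]; first by have [] := d x i.
rewrite (_ : 'D_(basis_vec R i) _ = fun=> basis_vec R i 0 j).
  exact: Ck_cst.
by apply/funext => x; have [_] := d x i.
Qed.

(* No general chain rule is used: along each coordinate direction, L moves in a
   coordinate direction of its target or not at all. *)
Lemma Ck_comp n p m (L : 'rV[R]_n -> 'rV[R]_p) (U : set 'rV[R]_p)
    (f : 'rV[R]_p -> R) : continuous L -> open U ->
  (forall i, exists2 w, w = 0 \/ (exists c j, w = c *: basis_vec R j) &
     forall x (h : R), L (h *: basis_vec R i + x) = h *: w + L x) ->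
  Ck m U f -> Ck m (L @^-1` U) (f \o L).
Proof.
move=> cL oU hL.
have oLU : open (L @^-1` U) by apply: open_comp => // x _; exact: cL.
elim: m f => [|m ih] f [cf df].
  by split=> // x Ux; apply: continuous_comp; [exact: cL|exact: cf].
split=> [x Ux|i]; first by apply: continuous_comp; [exact: cL|exact: cf].
have [w hw Lw] := hL i.
(* The restriction of [f \o L] to the line through [x] along the basis vector is that of [f] to the
   line through [L x] along [w]. *)
have e x d : is_derive (L x) w f d -> is_derive x (basis_vec R i) (f \o L) d.
  move=> /is_derive_line h; apply/is_derive_line; move: h.
  by congr is_derive; apply/funext => h /=; rewrite Lw.
case: hw => [w0|[c [j wj]]].
  have d0 x : is_derive x (basis_vec R i) (f \o L) 0.
    by apply: e; rewrite w0; exact: is_derive0.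
  split=> [x _|]; first by have [] := d0 x.
  rewrite (_ : 'D_(basis_vec R i) (f \o L) = fun=> 0); first exact: Ck_cst.
  by apply/funext => x; have [_] := d0 x.
have [df1 df2] := df j.
have dx x : (L @^-1` U) x ->
    is_derive x (basis_vec R i) (f \o L) (c * 'D_(basis_vec R j) f (L x)).
  move=> Ux; apply: e; rewrite wj; apply: is_derive_dirZ.
  exact/derivableP/df1.
split=> [x Ux|]; first by have [] := dx _ Ux.
apply: Ck_eq (CkM oLU (Ck_cst m _ c) (ih _ df2)) => // x /set_mem Ux.
by have [_ ->] := dx _ Ux.
Qed.

End CkTheory.

Section KSmooth.
Variables (R : realType) (s : scalars).
Local Notation k := (field_of R s).
Implicit Types n : nat.

Lemma ksmooth_cst n (U : set 'rV[R]_n) (a : k) : ksmooth_on U (fun=> a).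
Proof. by split=> m; exact: Ck_cst. Qed.

Lemma ksmooth_eq n (U : set 'rV[R]_n) (f g : 'rV[R]_n -> k) : open U ->
  {in U, f =1 g} -> ksmooth_on U f -> ksmooth_on U g.
Proof.
move=> oU fg [h1 h2]; split=> m.
  by apply: Ck_eq (h1 m) => // x xU /=; rewrite fg.
by apply: Ck_eq (h2 m) => // x xU /=; rewrite fg.
Qed.

Lemma ksmooth_sub n (U W : set 'rV[R]_n) (f : 'rV[R]_n -> k) :
  W `<=` U -> ksmooth_on U f -> ksmooth_on W f.
Proof. by move=> WU [h1 h2]; split=> m; apply: Ck_sub WU _. Qed.

Lemma ksmooth_local n (U : set 'rV[R]_n) (f : 'rV[R]_n -> k) :
  (forall x, U x -> exists2 W : set 'rV[R]_n, W x & ksmooth_on W f) ->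
  ksmooth_on U f.
Proof.
move=> h; split=> m; apply: Ck_local => x /h [W Wx [h1 h2]]; exists W => //.
Qed.

Lemma ksmoothD n (U : set 'rV[R]_n) (f g : 'rV[R]_n -> k) : open U ->
  ksmooth_on U f -> ksmooth_on U g -> ksmooth_on U (fun x => f x + g x).
Proof.
move=> oU [f1 f2] [g1 g2]; split=> m.
  by apply: Ck_eq (CkD oU (f1 m) (g1 m)) => // x _ /=; rewrite kreD.
by apply: Ck_eq (CkD oU (f2 m) (g2 m)) => // x _ /=; rewrite kimD.
Qed.

Lemma ksmoothM n (U : set 'rV[R]_n) (f g : 'rV[R]_n -> k) : open U ->
  ksmooth_on U f -> ksmooth_on U g -> ksmooth_on U (fun x => f x * g x).
Proof.
move=> oU [f1 f2] [g1 g2]; split=> m.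
  have h := CkD oU (CkM oU (f1 m) (g1 m))
    (CkM oU (Ck_cst m U (-1)) (CkM oU (f2 m) (g2 m))).
  by apply: Ck_eq h => // x _ /=; rewrite kreM mulN1r.
have h := CkD oU (CkM oU (f1 m) (g2 m)) (CkM oU (f2 m) (g1 m)).
by apply: Ck_eq h => // x _ /=; rewrite kimM.
Qed.

Lemma ksmooth_sum n (U : set 'rV[R]_n) (I : Type) (r : seq I)
    (F : I -> 'rV[R]_n -> k) : open U ->
  (forall i, ksmooth_on U (F i)) -> ksmooth_on U (fun x => \sum_(i <- r) F i x).
Proof.
move=> oU h; elim: r => [|i r ih].
  by under eq_fun do rewrite big_nil; exact: ksmooth_cst.
by under eq_fun do rewrite big_cons; exact: ksmoothD.
Qed.

Lemma ksmooth_kmk n (U : set 'rV[R]_n) (f g : 'rV[R]_n -> R) :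
  smooth_on U f -> smooth_on U g -> ksmooth_on U (fun x => kmk s (f x) (g x)).
Proof.
case: s => hf hg; split=> m; try exact: hf; try exact: hg.
exact: Ck_cst.
Qed.

Lemma ksmooth_comp n p (L : 'rV[R]_n -> 'rV[R]_p) (U : set 'rV[R]_p)
    (f : 'rV[R]_p -> k) : continuous L -> open U ->
  (forall i, exists2 w, w = 0 \/ (exists c j, w = c *: basis_vec R j) &
     forall x (h : R), L (h *: basis_vec R i + x) = h *: w + L x) ->
  ksmooth_on U f -> ksmooth_on (L @^-1` U) (f \o L).
Proof.
move=> cL oU hL [h1 h2]; split=> m; first exact: (Ck_comp cL oU hL (h1 m)).
exact: (Ck_comp cL oU hL (h2 m)).
Qed.

End KSmooth.

(** * Linear differential equations and the finite-dimensional setting *)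

Section LinearODE.
Variable R : realType.
Implicit Types (e : nat -> R) (t : R).

Lemma limn_series_head (u : nat -> R) : (forall n, u n.+1 = 0) ->
  series u @ \oo --> u 0%N.
Proof.
move=> u0; apply: (cvg_near_cst); exists 1%N => //= n /= n1.
rewrite /series /= -(prednK n1) big_nat_recl// big1 ?addr0//.
Qed.

(* Coefficients of the exponential generating function of e. *)
Definition egf e n : R := e n / n`!%:R.

(** Since [(n+1) / (n+1)! = 1 / n!], formal differentiation shifts the sequence. *)
Lemma pseries_diffs_egf e : pseries_diffs (egf e) = egf (fun n => e n.+1).
Proof.
apply/funext => n; rewrite /pseries_diffs /egf factS natrM invfM.
by rewrite mulrCA mulVKf.
Qed.

(** Comparison with [C] times the exponential series at [K * |t|]. *)
Lemma is_cvg_pseries_egf e (C K t : R) : 0 <= C -> 0 <= K ->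
  (forall n, `|e n| <= C * K ^+ n) -> cvgn (pseries (egf e) t).
Proof.
move=> C0 K0 eb; apply: normed_cvg.
apply: (@series_le_cvg _ _ (fun n => C * exp_coeff (K * `|t|) n)).
- by move=> n; exact: normr_ge0.
- by move=> n; rewrite mulr_ge0// exp_coeff_ge0// mulr_ge0.
- move=> n; rewrite /egf /exp_coeff /= !normrM normfV normr_nat normrX exprMn.
  rewrite mulrAC !mulrA ler_wpM2r// ?invr_ge0//.
  by rewrite ler_wpM2r// exprn_ge0.
- exact: is_cvg_seriesZ (is_cvg_series_exp_coeff _).
Qed.

Lemma is_derive_egf e (C K t : R) : 0 <= C -> 0 <= K ->
  (forall n, `|e n| <= C * K ^+ n) ->
  is_derive t 1 (fun r => limn (pseries (egf e) r))
    (limn (pseries (egf (fun n => e n.+1)) t)).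
Proof.
move=> C0 K0 eb.
(* Termwise differentiation asks for convergence of the series and of its first two formal
   derivatives at a point of modulus greater than [|t|], here [|t| + 1]. The shifted sequences
   satisfy the same kind of bound, with [C] multiplied by [K] at each shift. *)
have eb1 n : `|e n.+1| <= C * K * K ^+ n by rewrite -mulrA -exprS.
have eb2 n : `|e n.+2| <= C * K * K * K ^+ n by rewrite -mulrA -exprS.
rewrite -pseries_diffs_egf.
have CK : 0 <= C * K by exact: mulr_ge0.
apply: (@pseries_snd_diffs _ _ (`|t| + 1)); rewrite ?pseries_diffs_egf.
- exact: is_cvg_pseries_egf C0 K0 eb.
- exact: is_cvg_pseries_egf CK K0 eb1.
- exact: (is_cvg_pseries_egf (mulr_ge0 CK K0) K0 eb2).
- by rewrite [ltRHS]ger0_norm ?addr_ge0// ltrDl.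
Qed.

(* The solution is the exponential generating function of the sequence e with
   e_0 = x0, e_1 = w + x0 M and e_(n+2) = e_(n+1) M. *)
Lemma linear_ode (J : finType) (M : J -> J -> R) (w x0 : J -> R) :
  exists x : J -> R -> R, (forall j, x j 0 = x0 j) /\
    forall j t, is_derive t 1 (x j) (w j + \sum_i x i t * M i j).
Proof.
pose e := fix e (n : nat) (j : J) {struct n} : R := if n is m.+1
  then (if m is 0%N then w j else 0) + \sum_i e m i * M i j else x0 j.
(* These constants give [|e_n| <= C K^n]: [C] bounds the initial value and [w], and the summand 1 in
   [K] leaves room for [w] in the step from [e_0] to [e_1]. *)
pose C := \sum_i (`|x0 i| + `|w i|).
pose K := 1 + \sum_i \sum_j `|M i j|.
have C0 : 0 <= C by apply: sumr_ge0 => i _; exact: addr_ge0.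
have K0 : 0 <= K.
  by apply: addr_ge0 => //; apply: sumr_ge0 => i _; exact: sumr_ge0.
have K1 : 1 <= K.
  by rewrite /K lerDl; apply: sumr_ge0 => i _; exact: sumr_ge0.
have leC i : `|x0 i| + `|w i| <= C.
  rewrite /C (bigD1 i)//= lerDl; apply: sumr_ge0 => l _; exact: addr_ge0.
have eb n j : `|e n j| <= C * K ^+ n.
  elim: n j => [|n ih] j.
    by rewrite expr0 mulr1 (le_trans _ (leC j))// lerDl.
  rewrite [e _ _]/= (le_trans (ler_normD _ _))//.
  rewrite exprSr mulrA {2}/K mulrDr mulr1 lerD//.
    case: n {ih} => [|n]; last by rewrite normr0 mulr_ge0// exprn_ge0.
    by rewrite expr0 mulr1 (le_trans _ (leC j))// lerDr.
  rewrite (le_trans (ler_norm_sum _ _ _))// mulr_sumr ler_sum// => i _.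
  rewrite normrM ler_pM//.
  by rewrite (bigD1 j)//= lerDl; apply: sumr_ge0.
pose x j t := limn (pseries (egf (e^~ j)) t).
have cx j t : cvgn (pseries (egf (e^~ j)) t).
  exact: (is_cvg_pseries_egf C0 K0 (eb^~ j)).
exists x; split=> [j|j t].
  apply: cvg_lim => //.
  have := @limn_series_head (fun n => egf (e^~ j) n * 0 ^+ n).
  rewrite /egf /= fact0 divr1 expr0 mulr1; apply => n.
  by rewrite expr0n mulr0.
have := is_derive_egf t C0 K0 (eb^~ j).
congr is_derive; apply: cvg_lim => //.
(* By the recursion, the shifted series splits into a series with the single term [w j] at index 0
   and the series of the components multiplied by the matrix. *)
pose u n : R := (if n is 0%N then w j else 0) / n`!%:R * t ^+ n.
rewrite (_ : pseries _ t = fun n => series u n +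
    \sum_i pseries (egf (e^~ i)) t n * M i j); last first.
  apply/funext => n; rewrite /pseries /series /=.
  under [X in _ = _ + X]eq_bigr do rewrite mulr_suml.
  rewrite exchange_big -big_split /=; apply: eq_bigr => m _.
  rewrite /u /egf /= !mulrDl; congr (_ + _).
  rewrite !mulr_suml; apply: eq_bigr => i _.
  by rewrite [RHS]mulrAC; congr (_ * _); rewrite mulrAC.
apply: cvgD.
  rewrite -[w j](_ : u 0%N = _).
    by apply: limn_series_head => n; rewrite /u !mul0r.
  by rewrite /u fact0 divr1 expr0 mulr1.
apply: cvg_big => [|i _]; first exact: add_continuous.
by apply: cvgM; [exact: cx|exact: cvg_cst].
Qed.

End LinearODE.

Section FiniteDimensionalSetting.
Variables (R : realType) (s : scalars) (A : mcp (field_of R s)).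
Local Notation k := (field_of R s).

Lemma fd_curve_scale (c c' : R -> A 1) (a b r a' b' : R) :
  fd_curve c c' a b -> (forall u, a' < u < b' -> a < r * u < b) ->
  fd_curve (fun u => c (r * u)) (fun u => kreal s r *: c' (r * u)) a' b'.
Proof.
move=> cc ab t tab phi; rewrite linearZ.
exact: (@has_deriv_scale _ _ (fun u => phi (c u))) (cc _ (ab _ tab) phi).
Qed.

(** The system is rewritten as a real one of twice the size, with real parts indexed by [inl] and
    imaginary parts by [inr]. Over the reals the second half is solved as well and then dropped by
    [kmk]. *)
Lemma k_linear_ode n (M : 'I_n -> 'I_n -> k) (w z0 : 'I_n -> k) :
  exists z : 'I_n -> R -> k, (forall i, z i 0 = z0 i) /\
    forall i t, has_deriv (z i) t (w i + \sum_l z l t * M l i).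
Proof.
pose N (p q : 'I_n + 'I_n) : R := match p, q with
  | inl l, inl i => kre (M l i)
  | inr l, inl i => - kim (M l i)
  | inl l, inr i => kim (M l i)
  | inr l, inr i => kre (M l i)
  end.
pose split_ (v : 'I_n -> k) (p : 'I_n + 'I_n) : R :=
  match p with inl i => kre (v i) | inr i => kim (v i) end.
have [x [x0 dx]] := linear_ode N (split_ w) (split_ z0).
exists (fun i t => kmk s (x (inl i) t) (x (inr i) t)); split=> [i|i t].
  by rewrite !x0 /= kmkK.
have := dx (inl i) t; have := dx (inr i) t.
rewrite !big_sumType /= -!big_split /=.
(* Over the reals [kmk] forgets [b], but [kim y = 0] makes both sides vanish. *)
have kimK (a b : R) (y : k) : kim (kmk s a b) * kim y = b * kim y.
  by case: s y => //= y; rewrite !mulr0.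
move=> h2 h1; split.
  rewrite kreD kre_sum; move: h1; congr is_derive.
    by apply/funext => u /=; rewrite kre_mk.
  congr (_ + _); apply: eq_bigr => l _.
  by rewrite kreM kre_mk kimK mulrN.
case: s M w z0 @N @split_ {h1 dx kimK} x x0 h2 => M w z0 N split_ x x0 h.
  exact: is_derive_cst.
rewrite kimD kim_sum; move: h; congr is_derive; congr (_ + _).
by apply: eq_bigr => l _; rewrite kimM.
Qed.

(** Used for coordinates on [L^1] in finite dimension and for trivialisations of bundle fibres;
    [psi] is linear as the inverse of a linear map. *)
Lemma linear_coord (V W : lmodType k) n (phi : {linear V -> 'rV[k]_n})
    (psi : 'rV[k]_n -> V) (f : V -> W) : cancel phi psi -> cancel psi phi ->
  linear f -> forall v, f v = \sum_i phi v 0 i *: f (psi (delta_mx 0 i)).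
Proof.
move=> phiK psiK lf v.
pose f' : {linear V -> W} := HB.pack f (GRing.isLinear.Build _ _ _ _ f lf).
pose psi' : {linear 'rV[k]_n -> V} :=
  HB.pack psi (GRing.isLinear.Build _ _ _ _ psi (can2_linear phiK psiK)).
rewrite -[in LHS](phiK v) [in LHS](row_sum_delta (phi v)).
rewrite -[psi]/(psi' : _ -> _) -[f]/(f' : _ -> _) !linear_sum.
by apply: eq_bigr => i _; rewrite !linearZ.
Qed.

Lemma fd_gauge_flow (X : A 1) (lam : A 0) : finite_dim (A 1) ->
  exists Y, gauge_by (@fd_curve R s A) lam X Y.
Proof.
move=> [n [phi [psi phiK psiK]]].
pose T v := lie_br deg10 v lam.
have lT : linear T by exact: lie_br_linl.
have [z [z0 dz]] := k_linear_ode
  (fun l i => phi (T (psi (delta_mx 0 l))) 0 i)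
  (fun i => phi (lie_d A deg01 lam) 0 i) (fun i => phi X 0 i).
pose c t := psi (\row_i z i t).
have phic t i : phi (c t) 0 i = z i t by rewrite psiK mxE.
(* The solution exists for all times; []-1, 2[] is one open interval around [[0, 1]]. *)
exists (c 1), c, (-1), 2; split=> //; rewrite ?ltrN10 ?ltr1n//; last first.
  by rewrite -[RHS]phiK; congr psi; apply/rowP => i; rewrite mxE z0.
move=> t _ f.
have lf : linear (f : A 1 -> k^o) by exact: linearP.
rewrite (linear_coord phiK psiK lf).
rewrite (_ : (fun u => _) =
    fun u => \sum_i f (psi (delta_mx 0 i)) * z i u); last first.
  apply/funext => u; rewrite (linear_coord phiK psiK lf).
  by apply: eq_bigr => i _; rewrite phic mulrC.
apply: has_deriv_sum => i; rewrite [X in has_deriv _ _ X]mulrC.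
apply: has_derivMl; have := dz i t; congr has_deriv.
rewrite /gauge_field linearD mxE; congr (_ + _).
rewrite -/(T _) (linear_coord phiK psiK lT) linear_sum summxE.
by apply: eq_bigr => l _; rewrite linearZ mxE phic.
Qed.

Lemma fd_linear_smooth (b : mcp_B A 2) :
  fd_smooth (fun X : A 1 => pair deg11 X b).
Proof.
move=> n v.
apply: (@ksmooth_eq _ _ _ _
  (fun t : 'rV[R]_n => \sum_j kreal s (t 0 j) * pair deg11 (v j) b)).
- exact: openT.
- move=> t _ /=; rewrite -[RHS]/((fun X => pair deg11 X b) _).
  elim/big_rec2: _ => [|i y x _ ->].
    by rewrite -[X in pair _ X b](scale0r (0 : A 1)) pairZl mul0r.
  by rewrite pairDl pairZl.
apply: ksmooth_sum => [|j]; first exact: openT.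
apply: ksmoothM; [exact: openT| |exact: ksmooth_cst].
by apply: ksmooth_kmk => m; [exact: Ck_coord|exact: Ck_cst].
Qed.

Lemma fd_linear_derivative (b : mcp_B A 2) (c c' : R -> A 1) (lo hi t : R) :
  fd_curve c c' lo hi -> lo < t < hi ->
  has_deriv (fun u => pair deg11 (c u) b) t (pair deg11 (c' t) b).
Proof.
move=> cc tab.
pose f : {linear A 1 -> k^o} := HB.pack (fun X : A 1 => pair deg11 X b : k^o)
  (GRing.isLinear.Build _ _ _ _ (fun X : A 1 => pair deg11 X b : k^o)
    (pair_linl deg11 b)).
exact: (cc t tab f).
Qed.

End FiniteDimensionalSetting.

(** * Integration over compact manifolds *)

Section BorelIntegration.
Variables (R : realType) (T : ptopologicalType).
Local Notation borel := (g_sigma_algebraType (@open T)).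
Variable mu : {measure set borel -> \bar R}.

Lemma open_borel (U : set T) : open U -> measurable (U : set borel).
Proof. by move=> oU; exact: sub_sigma_algebra. Qed.

Lemma continuous_borel_measurable (f : T -> R) : continuous f ->
  measurable_fun [set: borel] f.
Proof.
move=> cf.
apply: (measurability _ (measurable_realfun.RGenOpens.measurableE R)).
move=> _ [_ [x [y ->]] <-]; rewrite setTI; apply: open_borel.
by apply: open_comp => [z _|]; [exact: cf|exact: interval_open].
Qed.

(* F consists of the families that contain all supersets of some set of finite
   measure; the near-covering form of compactness, applied to F and to the
   membership relation, shows that T itself has finite measure. *)
Lemma compact_measure_finite : compact [set: T] ->
  (forall x, exists2 V : set borel, measurable V /\ (mu V < +oo)%E &
    nbhs (x : T) (V : set T)) ->
  (mu setT < +oo)%E.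
Proof.
move=> /compact_near_coveringP cT loc.
pose F : set_system (set T) := [set Q | exists2 V : set borel,
  measurable V /\ (mu V < +oo)%E & forall B : set T, V `<=` B -> Q B].
have FF : Filter F.
  split=> [|P Q [V [mV fV] VP] [W [mW fW] WQ]|P Q PQ [V mV VP]].
  - by exists set0 => //; rewrite measure0 ltry; split.
  - exists (V `|` W); last first.
      move=> B VWB; split; [apply: VP|apply: WQ].
        exact: subset_trans VWB.
      exact: subset_trans VWB.
    split; first exact: measurableU.
    by apply: le_lt_trans (measureU2 _ mV mW) _; rewrite lte_add_pinfty.
  - by exists V => // B /VP; exact: PQ.
have [|V [mV fV] VT] := cT _ F (fun B x => B x) FF.
  move=> x _; have [V mV xV] := loc x.
  exists (V, [set B | V `<=` B]) => /=; first by split=> //; exists V.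
  by move=> [y B] /= [Vy]; exact.
(* [VT] says that every superset of [V] contains all points; it is applied to [V] itself. *)
suff -> : setT = V by [].
by apply/seteqP; split=> // x _; exact: (VT V).
Qed.

(** Near each point [|f x| + 1] is a bound; near-covering compactness, with the bound tending to
    [+oo], makes it uniform. The resulting [M] is a threshold above which every number is a bound,
    hence [M + 1]. *)
Lemma continuous_compact_bounded (f : T -> R) : compact [set: T] ->
  continuous f -> exists M : R, forall x, `|f x| <= M.
Proof.
move=> /compact_near_coveringP cT cf.
have [|M [_ h]] := cT _ (pinfty_nbhs R) (fun M x => `|f x| <= M) _.
  move=> x _.
  exists ([set y | `|f y| < `|f x| + 1], [set M | `|f x| + 1 < M]) => /=.
    split; last by exists (`|f x| + 1); split.
    apply: (@cvgr_norm_lt _ R^o _ (nbhs x) _ f (f x)); first exact: cf.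
    by rewrite ltrDl.
  by move=> [y N] /= [/ltW h1 /ltW h2]; exact: le_trans h2.
by exists (M + 1) => x; apply: h => //; rewrite ltrDl.
Qed.

Hypothesis cT : compact [set: T].
Hypothesis fin_mu : (mu setT < +oo)%E.

Lemma bounded_integrable (f : borel -> R) (C : R) :
  measurable_fun [set: borel] f -> (forall x, `|f x| <= C) ->
  mu.-integrable setT (EFin \o f).
Proof.
move=> mf fC; apply: measurable_bounded_integrable => //.
exists C; split; first exact: num_real.
by move=> M CM x _; apply: le_trans (fC x) (ltW CM).
Qed.

(** Dominated differentiation: compactness turns the local bounds on [g'] into a constant one, which
    is integrable because the measure is finite. *)
Lemma is_derive_integral (g g' : R -> T -> R) (lo hi t : R) :
  lo < t < hi ->
  (forall u, lo < u < hi -> continuous (g u)) ->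
  (forall u x, lo < u < hi -> is_derive u 1 (g^~ x) (g' u x)) ->
  (forall x0 : T, exists C : R,
    \forall x \near x0 & u \near t, `|g' u x| <= C) ->
  is_derive t 1 (fun u => \int[mu]_(x in setT) g u x)
    (\int[mu]_(x in setT) g' t x).
Proof.
move=> tab cg dg bg.
have /compact_near_coveringP nc := cT.
(* The filter lets the time tend to [t] and the bound to [+oo] together, so one neighbourhood [U] of
   [t] and one threshold [M] serve all points. *)
have [|[U V] /= [nU [M [_ nV]]] UV] :=
  nc _ (filter_prod (nbhs t) (pinfty_nbhs R)) (fun p x => `|g' p.1 x| <= p.2) _.
  move=> x _; have [C [[/= W U] [/= nW nU] WU]] := bg x.
  exists (W, U `*` [set M | C < M]) => /=.
    split=> //; exists (U, [set M | C < M]) => //=; split=> //.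
    exact: nbhs_pinfty_gt (num_real C).
  by move=> [y [u M]] /= [Wy [Uu /ltW CM]]; apply: le_trans (WU (y, u) _) CM.
have : \forall u \near t, U u /\ u \in `]lo, hi[.
  apply: filterI => //; apply: (@near_in_itvoo _ lo hi); by rewrite in_itv.
move=> /nbhs_ballP [e /= e0 eU].
have inU u : u \in `]t - e, t + e[ -> U u /\ lo < u < hi.
  rewrite in_itv /= => h.
  have /eU [Uu] : ball t e u by rewrite /ball /= distrC ltr_distl.
  by rewrite in_itv.
have tI : t \in `]t - e, t + e[.
  by rewrite in_itv /= ltrDl e0 andbT ltrBlDr ltrDl.
have g'E u x : lo < u < hi -> partial1of2 g u x = g' u x.
  by move=> ul; rewrite partial1of2E; have [_] := dg u x ul.
have bd u (x : borel) : u \in `]t - e, t + e[ -> `|partial1of2 g u x| <= M + 1.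
  move=> /inU [Uu ul]; rewrite g'E//.
  by apply: (UV (u, M + 1)) => //=; split=> //; apply: nV; rewrite ltrDl.
have M0 : 0 <= M + 1 by exact: le_trans (bd _ point tI).
have intg u : u \in `]t - e, t + e[ ->
    mu.-integrable [set: borel] (EFin \o g u).
  move=> /= /inU [_ ul]; have cgu := cg _ ul.
  have [N gN] := continuous_compact_bounded cT cgu.
  by apply: (bounded_integrable _ gN); exact: continuous_borel_measurable.
have dgu u (x : borel) : u \in `]t - e, t + e[ -> setT x ->
    derivable (g^~ x) u 1.
  by move=> /= /inU [_ ul] _; have [] := dg u x ul.
have iM : mu.-integrable [set: borel] (EFin \o (cst (M + 1))).
  by apply: (@bounded_integrable _ (M + 1)) => // x; rewrite ger0_norm.
apply: DeriveDef.
  exact: (@derivable_under_integral _ _ borel mu g setT measurableT t (t - e)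
    (t + e) tI intg dgu (cst (M + 1)) (fun=> M0) iM (fun u x h _ => bd u x h)).
rewrite -derive1E (@differentiation_under_integral _ _ borel mu g setT
  measurableT t (t - e) (t + e) tI intg dgu (cst (M + 1)) (fun=> M0) iM
  (fun u x h _ => bd u x h)).
by apply: eq_Rintegral => x _; exact: g'E.
Qed.

End BorelIntegration.

Section ScalarContinuity.
Variables (R : realType) (s : scalars) (T : topologicalType).
Local Notation k := (field_of R s).

(** Continuity is stated on real and imaginary parts, to match [has_deriv] and [ksmooth_on]. *)
Definition kcontinuous_at (x : T) (u : T -> k) : Prop :=
  {for x, continuous (@kre R s \o u)} /\ {for x, continuous (@kim R s \o u)}.

Lemma kcontinuousD x (u v : T -> k) : kcontinuous_at x u ->
  kcontinuous_at x v -> kcontinuous_at x (fun y => u y + v y).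
Proof.
move=> [u1 u2] [v1 v2]; split.
  rewrite (_ : _ \o _ = (fun y => kre (u y) + kre (v y))).
    exact: cvgD u1 v1.
  by apply/funext => y /=; rewrite kreD.
rewrite (_ : _ \o _ = (fun y => kim (u y) + kim (v y))).
  exact: cvgD u2 v2.
by apply/funext => y /=; rewrite kimD.
Qed.

Lemma kcontinuousM x (u v : T -> k) : kcontinuous_at x u ->
  kcontinuous_at x v -> kcontinuous_at x (fun y => u y * v y).
Proof.
move=> [u1 u2] [v1 v2]; split.
  rewrite (_ : _ \o _ =
      (fun y => kre (u y) * kre (v y) - kim (u y) * kim (v y))).
    exact: cvgB (cvgM u1 v1) (cvgM u2 v2).
  by apply/funext => y /=; rewrite kreM.
rewrite (_ : _ \o _ =
    (fun y => kre (u y) * kim (v y) + kim (u y) * kre (v y))).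
  exact: cvgD (cvgM u1 v2) (cvgM u2 v1).
by apply/funext => y /=; rewrite kimM.
Qed.

Lemma kcontinuous_sum x (I : Type) (r : seq I) (u : I -> T -> k) :
  (forall i, kcontinuous_at x (u i)) ->
  kcontinuous_at x (fun y => \sum_(i <- r) u i y).
Proof.
move=> hu; elim: r => [|i r ih].
  by under eq_fun do rewrite big_nil; split; exact: cvg_cst.
by under eq_fun do rewrite big_cons; exact: kcontinuousD.
Qed.

Lemma kcontinuous_near x (u v : T -> k) : {near x, u =1 v} ->
  kcontinuous_at x u -> kcontinuous_at x v.
Proof.
move=> uv [u1 u2]; split; [apply: near_continuous u1|apply: near_continuous u2];
  by apply: filterS uv => y /= ->.
Qed.

End ScalarContinuity.

(** * Charts, finiteness of the volume, and smooth functions on a manifold *)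

Section ManifoldTheory.
Variables (R : realType) (M : manifold R).

(** Inside the open chart image, the set is the preimage of [W] under [cinv p], which is continuous
    there. *)
Lemma chart_image_open (p : chart M) (W : set M) : open W ->
  open (Defs.coord p @` (cdom p `&` W)).
Proof.
move=> oW; rewrite openE => _ [x [px Wx] <-].
have ipx : (Defs.coord p @` cdom p) (Defs.coord p x) by exists x.
have n1 : nbhs (Defs.coord p x) (Defs.coord p @` cdom p).
  by apply: open_nbhs_nbhs; split=> //; exact: cimg_open.
have n2 : nbhs (Defs.coord p x) (cinv p @^-1` W).
  apply: (cinv_cont ipx); rewrite cinvK//.
  exact: open_nbhs_nbhs.
apply: filterS2 n1 n2 => _ [z pz <-]; rewrite /= cinvK// => Wz.
by exists z.
Qed.

Lemma box_compact n (u v : 'rV[R]_n) : compact (box u v).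
Proof.
have := @rV_compact R n (fun i => `[u 0 i, v 0 i]%classic)
  (fun i => @segment_compact _ _ _).
by congr compact; apply/seteqP; split=> y h i; have := h i; rewrite /= in_itv.
Qed.

(** A closed coordinate box around [x] has a real number as its measure by [vol_measE]; its image is
    compact, hence closed and measurable. *)
Lemma vol_locally_finite (mu : volume_form M) (x : M) :
  exists2 V : set (g_sigma_algebraType (@open M)),
    measurable V /\ (vol_meas mu V < +oo)%E & nbhs (x : M) (V : set M).
Proof.
have [p px] := cdom_cover x.
have ipx : (Defs.coord p @` cdom p) (Defs.coord p x) by exists x.
have : nbhs (Defs.coord p x) (Defs.coord p @` cdom p).
  by apply: open_nbhs_nbhs; split=> //; exact: cimg_open.
move=> /nbhs_ballP [e /= e0 eV].
(* With half the radius, the closed box lies in the open ball, hence in the chart image. *)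
have e2 : 0 < e / 2 by rewrite divr_gt0.
have e2e : e / 2 < e by rewrite ltr_pdivrMr// ltr_pMr// ltr1n.
pose h : 'rV[R]_(mfd_dim M) := const_mx (e / 2).
have bV : box (Defs.coord p x - h) (Defs.coord p x + h) `<=`
    Defs.coord p @` cdom p.
  move=> y yb; apply: eV; split=> // i j; have := yb j.
  rewrite !mxE (ord1 i) /ball /= distrC => hy.
  by apply: le_lt_trans e2e; rewrite ler_distl.
exists (cinv p @` box (Defs.coord p x - h) (Defs.coord p x + h)).
  split; last first.
    rewrite (vol_measE mu _ bV) ?ltry// => i.
    by rewrite !mxE lerD2l (le_trans _ (ltW e2))// oppr_le0 ltW.
  have : closed (cinv p @` box (Defs.coord p x - h) (Defs.coord p x + h)).
    apply: compact_closed; first exact: mfd_hausdorff.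
    apply: continuous_compact; last exact: box_compact.
    apply: continuous_in_subspaceT => y /set_mem /bV; exact: cinv_cont.
  rewrite -openC => /open_borel mC; rewrite -[X in measurable X]setCK.
  exact: measurableC.
have n1 : nbhs x (cdom p).
  by apply: open_nbhs_nbhs; split=> //; exact: cdom_open.
have n2 : nbhs x (Defs.coord p @^-1` (ball (Defs.coord p x) (e / 2))).
  by apply: (coord_cont px); exact: nbhsx_ballx.
apply: filterS2 n1 n2 => z pz [_ /= zb].
exists (Defs.coord p z); last exact: cinvK.
move=> i; have := zb 0 i; rewrite !mxE /ball /= distrC => /ltW.
by rewrite ler_distl.
Qed.

Lemma vol_finite (mu : volume_form M) : compact [set: M] ->
  (vol_meas mu setT < +oo)%E.
Proof.
move=> cM; apply: (compact_measure_finite cM) => x.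
exact: vol_locally_finite.
Qed.

Variable s : scalars.
Local Notation k := (field_of R s).

Lemma msmooth_eq (W : set M) (u v : M -> k) : open W ->
  {in W, u =1 v} -> msmooth_on W u -> msmooth_on W v.
Proof.
move=> oW uv su p; apply: ksmooth_eq (su p); first exact: chart_image_open.
by move=> _ /set_mem [x [px Wx] <-]; rewrite cinvK// uv ?inE.
Qed.

Lemma msmooth_sub (W W' : set M) (u : M -> k) : W' `<=` W ->
  msmooth_on W u -> msmooth_on W' u.
Proof.
move=> WW su p; apply: ksmooth_sub (su p) => _ [x [px /WW Wx] <-].
by exists x.
Qed.

Lemma msmooth_local (W : set M) (u : M -> k) :
  (forall x, W x -> exists2 W' : set M, W' x & msmooth_on W' u) ->
  msmooth_on W u.
Proof.
move=> h p; apply: ksmooth_local => _ [x [px /h [W' Wx su]] <-].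
by exists (Defs.coord p @` (cdom p `&` W')); [exists x|exact: su].
Qed.

Lemma msmoothM (W : set M) (u v : M -> k) : open W ->
  msmooth_on W u -> msmooth_on W v -> msmooth_on W (fun x => u x * v x).
Proof.
move=> oW su sv p.
by apply: ksmoothM; [exact: chart_image_open|exact: su|exact: sv].
Qed.

Lemma msmooth_sum (W : set M) (I : Type) (r : seq I) (u : I -> M -> k) :
  open W -> (forall i, msmooth_on W (u i)) ->
  msmooth_on W (fun x => \sum_(i <- r) u i x).
Proof.
move=> oW su p.
by apply: ksmooth_sum => [|i]; [exact: chart_image_open|exact: su].
Qed.

Lemma msmooth_continuous (W : set M) (u : M -> k) x : open W -> W x ->
  msmooth_on W u ->
  kcontinuous_at x u.
Proof.
move=> oW Wx su; have [p px] := cdom_cover x.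
have ipx : (Defs.coord p @` (cdom p `&` W)) (Defs.coord p x) by exists x.
have [/(_ 0%N) [c1 _] /(_ 0%N) [c2 _]] := su p.
have n1 : nbhs x (cdom p).
  by apply: open_nbhs_nbhs; split=> //; exact: cdom_open.
by split; [apply: near_continuous (continuous_comp (coord_cont px) (c1 _ ipx))
  |apply: near_continuous (continuous_comp (coord_cont px) (c2 _ ipx))];
  apply: filterS n1 => y py /=; rewrite cinvK.
Qed.

End ManifoldTheory.

(** * Vector bundles *)

Section RowVectors.
Variable R : realType.

Lemma cvg_rV (T : Type) (F : set_system T) n (f : T -> 'rV[R]_n)
    (v : 'rV[R]_n) :
  Filter F -> (forall i, f t 0 i @[t --> F] --> v 0 i) -> f t @[t --> F] --> v.
Proof.
move=> FF fv Q [P nP PQ].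
have h i : \forall t \near F, P 0 i (f t 0 i) by exact: fv (nP 0 i).
suff nQ : \forall t \near F, Q (f t) by exact: nQ.
have nw := filter_forall _ h.
near=> t; apply: PQ => i j; rewrite (ord1 i); move: j.
by near: t; exact: nw.
Unshelve. all: by end_near. Qed.

Lemma cvg_row_mx (T : Type) (F : set_system T) n (f : T -> R)
    (g : T -> 'rV[R]_n) (a : R) (v : 'rV[R]_n) :
  Filter F -> f t @[t --> F] --> a -> g t @[t --> F] --> v ->
  (row_mx (f t)%:M (g t) : 'rV[R]_(1 + n)) @[t --> F] --> row_mx a%:M v.
Proof.
move=> FF fa gv; apply: cvg_rV => i; case: (splitP i) => j ij.
  have -> : i = lshift n j by exact/val_inj.
  under eq_fun do rewrite row_mxEl (ord1 j) mxE eqxx mulr1n.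
  by rewrite row_mxEl (ord1 j) mxE eqxx mulr1n.
have -> : i = rshift 1 j by exact/val_inj.
under eq_fun do rewrite row_mxEr.
by rewrite row_mxEr; exact: cvg_comp gv (@coord_continuous R 1 n 0 j v).
Qed.

Lemma lsubmx00_continuous n :
  continuous (fun v : 'rV[R]_(1 + n) => lsubmx v 0 0).
Proof.
move=> v.
apply: (@continuous_comp _ _ _ lsubmx (fun w : 'M[R]_(1, 1) => w 0 0)).
  exact: continuous_lsubmx.
exact: coord_continuous.
Qed.

Lemma time_chart_open n (a b : R) (V : set 'rV[R]_n) : open V ->
  open [set v : 'rV[R]_(1 + n) | a < lsubmx v 0 0 < b /\ V (rsubmx v)].
Proof.
move=> oV.
have -> : [set v : 'rV[R]_(1 + n) | a < lsubmx v 0 0 < b /\ V (rsubmx v)] =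
    ((fun v : 'rV[R]_(1 + n) => lsubmx v 0 0) @^-1` `]a, b[) `&`
    (rsubmx @^-1` V).
  by apply/seteqP; split=> v /=; rewrite in_itv.
apply: openI; apply: open_comp => //; last first.
  by move=> v _; exact: continuous_rsubmx.
by move=> v _; exact: lsubmx00_continuous.
Qed.

Lemma scale_time_continuous n (r : R) : continuous
  (fun v : 'rV[R]_(1 + n) => row_mx (r * lsubmx v 0 0)%:M (rsubmx v)
    : 'rV[R]_(1 + n)).
Proof.
move=> v; apply: (@cvg_row_mx _ (nbhs (v : 'rV[R]_(1 + n))));
  last exact: continuous_rsubmx.
exact: cvgM (cvg_cst r) (@lsubmx00_continuous n v).
Qed.

(** The condition of [ksmooth_comp] for the projection to the first coordinates. *)
Lemma lsubmx_coordinatewise n m (i : 'I_(n + m)) :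
  exists2 w : 'rV[R]_n, w = 0 \/ (exists c j, w = c *: basis_vec R j) &
  forall (x : 'rV[R]_(n + m)) (h : R),
    lsubmx (h *: basis_vec R i + x) = h *: w + lsubmx x.
Proof.
case: (splitP i) => j ij.
  have -> : i = lshift m j by exact/val_inj.
  exists (1 *: basis_vec R j); first by right; exists 1, j.
  move=> x h; apply/rowP => z; rewrite scale1r !mxE.
  by rewrite eq_lshift.
have -> : i = rshift n j by exact/val_inj.
exists 0; first by left.
by move=> x h; apply/rowP => z; rewrite !mxE eq_lrshift mulr0.
Qed.

End RowVectors.

Section BundleSetting.
Variables (R : realType) (s : scalars) (A : mcp (field_of R s)).
Local Notation k := (field_of R s).
Variable D : bundle_data A.
Local Notation M := (bd_M D).

Lemma bundle_curve_scale (c c' : R -> A 1) (a b r a' b' : R) :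
  bundle_curve D c c' a b -> (forall u, a' < u < b' -> a < r * u < b) ->
  bundle_curve D (fun u => c (r * u)) (fun u => kreal s r *: c' (r * u)) a' b'.
Proof.
move=> [c1 c2] ab; split=> [p q l|t tab q x l qx]; last first.
  rewrite !linearZ mxE.
  exact: (@has_deriv_scale _ _ (fun u => tmap q x (bd_L D 1 x (c u)) 0 l))
    (c2 _ (ab _ tab) q x l qx).
pose W := Defs.coord p @` (cdom p `&` tdom q).
have oW : open W by apply: chart_image_open; exact: tdom_open.
have e (a0 : R) : (a0%:M : 'M[R]_1) 0 0 = a0 by rewrite mxE eqxx.
(* In the chart, the rescaled family is the old one composed with [(t, y) |-> (r * t, y)], which
   multiplies the time direction by [r] and fixes the others. *)
have := @ksmooth_comp R s _ _ _ _ _ 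
  (@scale_time_continuous R _ r) (@time_chart_open R _ a b _ oW) _ (c1 p q l).
set U := (X in ksmooth_on X _); set f := (X in ksmooth_on _ X).
move=> h; rewrite (_ : (fun v => _) = f); last first.
  by apply/funext => v; rewrite /f /= row_mxKl row_mxKr e.
apply: ksmooth_sub (h _).
  by move=> v [tv Wv]; rewrite /U /= row_mxKl row_mxKr e; split=> //; exact: ab.
move=> i; case: (splitP i) => j ij.
  exists (r *: basis_vec R i); first by right; exists r, i.
  move=> x h0; apply/rowP => z; rewrite !mxE.
  case: (splitP z) => z' ez; rewrite !mxE.
    have -> : z = lshift (mfd_dim M) z' by exact/val_inj.
    by rewrite (ord1 z') !mulr1n mulrDr mulrCA.
  have -> : z = rshift 1 z' by exact/val_inj.
  have -> : i = lshift (mfd_dim M) j by exact/val_inj.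
  by rewrite eqxx /= eq_rlshift !mulr0.
exists (1 *: basis_vec R i); first by right; exists 1, i.
move=> x h0; rewrite scale1r; apply/rowP => z; rewrite !mxE.
case: (splitP z) => z' ez; rewrite !mxE.
  have -> : z = lshift (mfd_dim M) z' by exact/val_inj.
  have -> : i = rshift 1 j by exact/val_inj.
  by rewrite (ord1 z') eq_lrshift !mulr0 !add0r.
by have -> : z = rshift 1 z' by exact/val_inj.
Qed.

End BundleSetting.

(** * Smoothness of the fibrewise pairing of sections *)

Section DualPairing.
Variables (R : realType) (s : scalars) (M : manifold R).
Local Notation k := (field_of R s).
Variables (E E' : vbundle s M) (d : duality E E').

(** The components of [sigma] in the frame dual to the one given by [q]. *)
Definition dual_coef (q : triv E) (sigma : forall x, E' x) (l : 'I_(trank q))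
  (x : M) : k := dual_pair d x (tinv q x (delta_mx 0 l)) (sigma x).

Lemma dual_pair_coord (q : triv E) (sigma : forall x, E' x) x (v : E x) :
  tdom q x ->
  dual_pair d x v (sigma x) = \sum_l tmap q x v 0 l * dual_coef sigma l x.
Proof.
move=> qx.
exact: (linear_coord (W := k^o) (tmapK qx) (tinvK qx) (dual_linl d (sigma x))).
Qed.

(** Near each point [sigma] is expanded in a trivialisation of [E']; its components are smooth, and
    so are the pairings of the two frames by [dual_smooth]. *)
Lemma dual_coef_smooth (q : triv E) (sigma : forall x, E' x)
    (l : 'I_(trank q)) :
  smooth_section sigma -> msmooth_on (tdom q) (dual_coef sigma l).
Proof.
move=> ss; apply: msmooth_local => x qx; have [q' qx'] := tdom_cover E' x.
exists (tdom q `&` tdom q'); first by split.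
have oqq : open (tdom q `&` tdom q') by apply: openI; exact: tdom_open.
apply: (@msmooth_eq _ _ _ _ (fun y => \sum_m tmap q' y (sigma y) 0 m *
  dual_pair d y (tinv q y (delta_mx 0 l)) (tinv q' y (delta_mx 0 m)))) => //.
  move=> y /set_mem [_ qy']; apply/esym.
  exact: (linear_coord (W := k^o) (tmapK qy') (tinvK qy')
    (dual_linr d (tinv q y (delta_mx 0 l)))).
apply: msmooth_sum => // m; apply: msmoothM => //; last exact: dual_smooth.
by apply: msmooth_sub (ss q' m); exact: subIsetr.
Qed.

Lemma dual_pair_smooth (sigma : forall x, E x) (tau : forall x, E' x) :
  smooth_section sigma -> smooth_section tau ->
  msmooth_on setT (fun x => dual_pair d x (sigma x) (tau x)).
Proof.
move=> ss st; apply: msmooth_local => x _; have [q qx] := tdom_cover E x.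
exists (tdom q) => //; have oq := @tdom_open _ _ _ _ q.
apply: (@msmooth_eq _ _ _ _
  (fun y => \sum_l tmap q y (sigma y) 0 l * dual_coef tau l y)) => //.
  by move=> y /set_mem qy; rewrite -dual_pair_coord.
apply: msmooth_sum => // l; apply: msmoothM => //.
exact: dual_coef_smooth.
Qed.

End DualPairing.

(** * The local functional given by an element of [B^2], and its derivative *)

Section LinearFunctional.
Variables (R : realType) (s : scalars) (A : mcp (field_of R s)).
Local Notation k := (field_of R s).
Variable D : bundle_data A.
Local Notation M := (bd_M D).
Variable b : mcp_B A 2.
Let d := bd_dual D deg11.
Let tau (x : M) := bd_B D 2 x b.
Let Phi (X : A 1) (x : M) : k := dual_pair d x (bd_L D 1 x X) (tau x).
(** By [bd_pairE], the pairing with [b] up to the sign given by [bd_sign]. *)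
Let f (X : A 1) : k := vol_integral (bd_mu D) (Phi X).

Lemma dual_lagrangian : is_lagrangian (bd_L D 1) 0 Phi.
Proof.
(* The empty word indexes the derivative of order 0, that is, the value of the section; the density
   is linear in it, with the components of [b] as coefficients. *)
move=> p q W; pose w0 : jet_index M 0 := existT _ ord0 [tuple].
exists (fun y j => \sum_l dual_coef d (q := q) tau l (cinv p y) * j (w0, l)).
  have oW : open (Defs.coord p @` W).
    by apply: chart_image_open; exact: tdom_open.
  set U := [set v | _].
  have oU : open U.
    by apply: open_comp oW => v _; exact: continuous_lsubmx.
  apply: ksmooth_sum => // l; apply: ksmoothM => //.
    apply: (@ksmooth_comp R s _ _ (@lsubmx R 1 _ _) _
      (fun y => dual_coef d tau l (cinv p y)) _ oW).
    - by move=> v; exact: continuous_lsubmx.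
    - exact: lsubmx_coordinatewise.
    - exact: (dual_coef_smooth d l (sec_smooth (bd_B D 2) b)).
  apply: ksmooth_kmk => m; apply: Ck_eq (Ck_coord m _ _) => // v _.
    by rewrite !mxE.
  by rewrite !mxE.
move=> X x [px qx]; rewrite /Phi (dual_pair_coord d tau _ qx) cinvK//.
apply: eq_bigr => l _; rewrite mulrC; congr (_ * _).
by rewrite /jet_coord /kpartial /= kmkK cinvK.
Qed.

(** [bundle_curve] gives the velocity at each point separately. Joint continuity follows because in
    a chart it is the time partial derivative of a jointly smooth function. *)
Lemma curve_velocity_continuous (c c' : R -> A 1) (lo hi t : R)
    (q : triv (bd_E D 1)) (l : 'I_(trank q)) (x0 : M) :
  bundle_curve D c c' lo hi -> lo < t < hi -> tdom q x0 ->
  let v (z : M * R) := tmap q z.1 (bd_L D 1 z.1 (c' z.2)) 0 l in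
  kcontinuous_at (x0, t) v.
Proof.
move=> [c1 c2] tab qx0 v; have [p px0] := cdom_cover x0.
have px0' : (Defs.coord p @` (cdom p `&` tdom q)) (Defs.coord p x0).
  by exists x0.
pose J (z : M * R) : 'rV[R]_(1 + mfd_dim M) :=
  row_mx (z.2)%:M (Defs.coord p z.1).
have cJ : {for (x0, t), continuous J}.
  apply: cvg_row_mx; first exact: cvg_snd.
  by apply: cvg_comp cvg_fst _; exact: coord_cont.
have nz : \forall z \near (x0, t), (cdom p `&` tdom q) z.1 /\ lo < z.2 < hi.
  have n1 : nbhs x0 (cdom p `&` tdom q).
    apply: open_nbhs_nbhs; split=> //.
    by apply: openI; [exact: cdom_open|exact: tdom_open].
  have n2 : \forall u \near t, u \in `]lo, hi[.
    by apply: (@near_in_itvoo _ lo hi); rewrite in_itv.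
  exists (cdom p `&` tdom q, [set u | u \in `]lo, hi[]) => //=.
pose i0 : 'I_(1 + mfd_dim M) := lshift _ 0.
(* The direction [i0] is that of time. *)
have Jt u x h : h *: basis_vec R i0 + J (x, u) = J (x, h + u).
  apply/rowP => i; case: (splitP i) => j ij; rewrite !mxE.
    have -> : i = lshift (mfd_dim M) j by exact/val_inj.
    rewrite (ord1 j) /i0 !eqxx mulr1; case: splitP => // j' _.
    by rewrite (ord1 j') !mxE.
  have -> : i = rshift 1 j by exact/val_inj.
  rewrite /i0 eq_rlshift mulr0 add0r; case: splitP => // j' e.
  by have := ltn_ord j'; rewrite -e.
have [s1 s2] := c1 p q l.
have J0 : lo < lsubmx (J (x0, t)) 0 0 < hi /\
    (Defs.coord p @` (cdom p `&` tdom q)) (rsubmx (J (x0, t))).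
  by rewrite /J row_mxKl row_mxKr mxE eqxx mulr1n.
(* Here [phi] stands for the real or the imaginary part; smoothness of order 1 makes the partial
   derivative of [F] along [i0] continuous. *)
have aux (phi : k -> R) (F := fun w : 'rV[R]_(1 + mfd_dim M) =>
    phi (tmap q (cinv p (rsubmx w))
      (bd_L D 1 (cinv p (rsubmx w)) (c (lsubmx w 0 0))) 0 l)) :
  (forall u x, lo < u < hi -> tdom q x ->
    is_derive u 1 (fun r => phi (tmap q x (bd_L D 1 x (c r)) 0 l))
      (phi (tmap q x (bd_L D 1 x (c' u)) 0 l))) ->
  smooth_on [set w : 'rV[R]_(1 + mfd_dim M) | lo < lsubmx w 0 0 < hi /\
    (Defs.coord p @` (cdom p `&` tdom q)) (rsubmx w)] F ->
  {for (x0, t), continuous (phi \o v)}.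
  move=> dphi sF; have [_ /(_ i0) [_ dF]] := sF 1%N.
  have cF := continuous_comp cJ (dF.1 (J (x0, t)) J0).
  apply: near_continuous cF; apply: filterS nz => -[x u] /= [[px qx] uab].
  have [_] : is_derive (J (x, u)) (basis_vec R i0) F (phi (v (x, u)));
    last by [].
  apply/is_derive_line.
  rewrite (_ : (fun h : R => _) =
    (fun r => phi (tmap q x (bd_L D 1 x (c r)) 0 l)) \o (fun h => h + u)).
    rewrite -[phi _]mulr1; apply: is_derive1_comp.
      by rewrite add0r; exact: dphi.
    by apply: is_derive_eq; rewrite addr0.
  apply/funext => h /=; rewrite Jt /F /J row_mxKl row_mxKr mxE eqxx mulr1n /=.
  by rewrite cinvK.
split; apply: aux => //.
  by move=> u x uab qx; have [] := c2 u uab q x l qx.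
by move=> u x uab qx; have [] := c2 u uab q x l qx.
Qed.

Lemma velocity_pairing_continuous (c c' : R -> A 1) (lo hi t : R) (x0 : M) :
  bundle_curve D c c' lo hi -> lo < t < hi ->
  kcontinuous_at (x0, t) (fun z : M * R => Phi (c' z.2) z.1).
Proof.
move=> cc tab; have [q qx0] := tdom_cover (bd_E D 1) x0.
apply: (@kcontinuous_near _ _ _ _ (fun z : M * R => \sum_l
  tmap q z.1 (bd_L D 1 z.1 (c' z.2)) 0 l * dual_coef d tau l z.1)).
  have n1 : nbhs x0 (tdom q).
    by apply: open_nbhs_nbhs; split=> //; exact: tdom_open.
  exists (tdom q, setT) => /=; first by split=> //; exact: filterT.
  by move=> [x u] /= [qx _]; rewrite /Phi (dual_pair_coord d tau _ qx).
apply: kcontinuous_sum => l; apply: kcontinuousM.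
  exact: (curve_velocity_continuous l cc tab qx0).
have [c1 c2] := msmooth_continuous (tdom_open q) qx0
  (dual_coef_smooth d l (sec_smooth (bd_B D 2) b)).
have cfst : {for (x0, t), continuous (@fst M R)} by exact: cvg_fst.
by split; [exact: (continuous_comp cfst c1)|exact: (continuous_comp cfst c2)].
Qed.

(** The integrand is differentiated pointwise, and joint continuity of the velocity pairing gives
    the local bounds needed to differentiate under the integral. *)
Lemma has_deriv_dual_integral (c c' : R -> A 1) (lo hi t : R) :
  bundle_curve D c c' lo hi -> lo < t < hi ->
  has_deriv (fun u => f (c u)) t (f (c' t)).
Proof.
move=> cc tab.
have dPhi u x : lo < u < hi ->
    has_deriv (fun r => Phi (c r) x) u (Phi (c' u) x).
  move=> uab; have [q qx] := tdom_cover (bd_E D 1) x.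
  rewrite /Phi (dual_pair_coord d tau _ qx).
  under eq_fun do rewrite (dual_pair_coord d tau _ qx).
  apply: has_deriv_sum => l; under eq_fun do rewrite mulrC.
  by rewrite mulrC; apply: has_derivMl; exact: (cc.2 _ uab).
have cPhi u x : kcontinuous_at x (Phi (c u)).
  apply: (msmooth_continuous openT) => //.
  by apply: dual_pair_smooth; exact: sec_smooth.
have bnd (phi : k -> R) x0 :
    {for (x0, t), continuous (phi \o (fun z : M * R => Phi (c' z.2) z.1))} ->
  exists C : R, \forall x \near x0 & u \near t, `|phi (Phi (c' u) x)| <= C.
  move=> h; exists (`|phi (Phi (c' t) x0)| + 1).
  have h1 : `|phi (Phi (c' t) x0)| < `|phi (Phi (c' t) x0)| + 1.
    by rewrite ltrDl.
  have n1 := @cvgr_norm_lt _ R^o _ (nbhs (x0, t)) _ _ _ h _ h1.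
  have n2 : \forall z \near (x0, t),
      `|phi (Phi (c' z.2) z.1)| <= `|phi (Phi (c' t) x0)| + 1.
    by near=> z; apply: ltW; near: z; exact: n1.
  exact: n2.
have fM := vol_finite (bd_mu D) (@bd_compact _ _ _ D).
apply: has_deriv_kmk.
  apply: (@is_derive_integral _ _ (vol_meas (bd_mu D)) (@bd_compact _ _ _ D) fM
    (fun u x => kre (Phi (c u) x)) (fun u x => kre (Phi (c' u) x)) lo hi) => //.
  - by move=> u _ x; have [] := cPhi u x.
  - by move=> u x uab; have [] := dPhi u x uab.
  - by move=> x0; apply: bnd; have [] := velocity_pairing_continuous x0 cc tab.
apply: (@is_derive_integral _ _ (vol_meas (bd_mu D)) (@bd_compact _ _ _ D) fM
  (fun u x => kim (Phi (c u) x)) (fun u x => kim (Phi (c' u) x)) lo hi) => //.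
- by move=> u _ x; have [] := cPhi u x.
- by move=> u x uab; have [] := dPhi u x uab.
- by move=> x0; apply: bnd; have [] := velocity_pairing_continuous x0 cc tab.
Unshelve. all: by end_near. Qed.

End LinearFunctional.

(** * The core hypotheses in both settings, and the hamiltonian flow *)

Section Observables.
Variables (R : realType) (s : scalars) (A : mcp (field_of R s)).
Local Notation k := (field_of R s).
Variable S : setting A.

Lemma setting_curve_scale (c c' : R -> A 1) (a b r a' b' : R) :
  curve S c c' a b -> (forall u, a' < u < b' -> a < r * u < b) ->
  curve S (fun u => c (r * u)) (fun u => kreal s r *: c' (r * u)) a' b'.
Proof.
by case: S => [fd|D gD]; [exact: fd_curve_scale|exact: bundle_curve_scale].
Qed.

Lemma setting_gauge_flow (X : A 1) (lam : A 0) : MC X ->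
  exists2 eps : k, eps != 0 & exists Y, gauge_by (curve S) (eps *: lam) X Y.
Proof.
case: S => [fd|D gD] mX; last first.
  by have [eps eps0 h] := gD lam; exists eps => //; exact: h.
exists 1; first exact: oner_neq0.
by rewrite scale1r; apply: fd_gauge_flow; have [] := fd.
Qed.

Lemma linear_observable (b : mcp_B A 2) :
  exists2 g, observable S g & forall X, is_derivative S g X b.
Proof.
suff [g fg dg] : exists2 g, functional S g & forall X, is_derivative S g X b.
  by exists g => //; split=> // X; exists b.
case: S => [fd|D gD].
  exists (fun X => pair deg11 X b); first exact: fd_linear_smooth.
  by move=> X c c' lo hi t cc tab _; exact: fd_linear_derivative cc tab.
(* The sign in [bd_pairE] is absorbed into [b], so that the pairing is an integral without prefactor
   and thus a local functional. *)
pose sg : k := (-1) ^+ bd_sign D 1.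
pose f X := vol_integral (bd_mu D)
  (fun x => dual_pair (bd_dual D deg11) x (bd_L D 1 x X)
    (bd_B D 2 x (sg *: b))).
have fE X : f X = pair deg11 X b.
  have sg0 : sg != 0 by rewrite signr_eq0.
  by apply: (mulfI sg0); rewrite -pairZr (bd_pairE D).
exists f.
  by exists 0, (fun X x => dual_pair (bd_dual D deg11) x (bd_L D 1 x X)
    (bd_B D 2 x (sg *: b))); split=> //; exact: dual_lagrangian.
move=> X c c' lo hi t cc tab _; rewrite -fE.
exact: has_deriv_dual_integral cc tab.
Qed.

End Observables.

Theorem proposition5p1 (R : realType) (s : scalars) (A : mcp (field_of R s))
    (S : setting A) (O : set (A 1)) (f : A 1 -> field_of R s)
    (c c' : R -> A 1) (a b t : R) :
  gauge_orbits S O -> observable S f ->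
  curve S c c' a b -> (forall u, a < u < b -> O (c u)) -> a < t < b ->
  let X := c t in
  let lam := mcp_rho X (mcp_delta X deg11 (D S f X)) in
  [/\ hamiltonian_evolution S O (class S O f) c t <-> c' t = nu X (D S f X),
      nu X (D S f X) = twisted_d X deg01 lam &
      twisted_d X deg01 lam = lie_d A deg01 lam + lie_br deg10 X lam].
Proof.
move=> gO of_ cc cO tab X lam; split=> //; last by rewrite -gauge_fieldE.
exact: (hamiltonian_evolutionP (@setting_curve_scale R s A S)
  (@setting_gauge_flow R s A S) (@linear_observable R s A S) gO of_ cc cO tab).
Qed.
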